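(* Let $A,R>0$ and let $\phi:\mathbb{C}\to\mathbb{R}$ satisfy $|\phi(z)-\phi(t)|\le A|z-t|$ for all $z,t\in\mathbb{C}$ and $\operatorname{supp}(\phi)\subset\{z:|z|\le R\}$. Let $n\ge55$ and let $P_n(z)=a_n\prod_{k=1}^n(z-\alpha_{k,n})$, $a_n\ne0$, be a polynomial of degree $n$ with integer coefficients and simple zeros. Then $$\left|\frac1n\sum_{k=1}^n\phi(\alpha_{k,n})-\int\phi\,d\mu_D\right|\le A(2R+1)\sqrt{\frac{\log\max(n,M(P_n))}{n}}.$$
   Context: $\mu_D$ is the normalized arclength measure on the unit circle, $d\mu_D(e^{it})=\frac{1}{2\pi}dt$. The Mahler measure is $M(P_n)=|a_n|\prod_{k=1}^n\max(1,|\alpha_{k,n}|)$. *)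

(* Defs.v *)
From mathcomp Require Import all_boot all_order all_algebra.
From mathcomp Require Import all_classical all_reals all_analysis.
From mathcomp Require Export complex.
Import Order.TTheory GRing.Theory Num.Theory.
Import numFieldNormedType.Exports.

Set Implicit Arguments.
Unset Strict Implicit.
Unset Printing Implicit Defensive.

Local Open Scope classical_set_scope.
Local Open Scope ring_scope.

(* The norm [`|z|] of [z : R[i]] is itself an element of [R[i]]; [cmod z] is
   the same number in [R]. *)
Definition cmod (R : realType) (z : R[i]) : R := ComplexField.Normc.normc z.

Lemma cmodE (R : realType) (z : R[i]) : `|z| = (cmod z)%:C%C.
Proof. by []. Qed.

Definition expi (R : realType) (t : R) : R[i] := Complex (cos t) (sin t).

(* Integral against the normalized arclength measure mu_D of the unit circle,
   d mu_D(e^{it}) = dt / (2 pi). *)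
Definition circle_integral (R : realType) (f : R[i] -> R) : R :=
  (2 * pi)^-1 * \int[lebesgue_measure]_(t in `[0, 2 * pi]) f (expi t).

(* [R[i]^o] carries the topology of the norm [`|z|]. *)
Definition fun_supp (R : realType) (f : R[i] -> R) : set R[i] :=
  closure [set z : R[i]^o | f z != 0].

(* [sval (closed_field_poly_normal P)] is the list of roots of [P], with
   multiplicity; [mahler_measureE] gives the product formula for an arbitrary
   enumeration of the roots. *)
Definition mahler_measure (R : realType) (P : {poly R[i]}) : R :=
  cmod (lead_coef P) *
  \prod_(z <- sval (closed_field_poly_normal P)) Num.max 1 (cmod z).

Lemma mahler_measureE (R : realType) (n : nat) (a : R[i])
    (alpha : 'I_n -> R[i]) : a != 0 ->
  mahler_measure (a *: \prod_(k < n) ('X - (alpha k)%:P)) =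
  cmod a * \prod_(k < n) Num.max 1 (cmod (alpha k)).
Proof.
move=> a0; rewrite /mahler_measure.
set P := a *: _.
have lP : lead_coef P = a.
  by rewrite lead_coefZ (monicP (monic_prod_XsubC _ _ _)) mulr1.
case: closed_field_poly_normal => r /=; rewrite lP {1}/P => /(scalerI a0).
rewrite -(big_map alpha xpredT (fun z => 'X - z%:P)) => e.
have rP : perm_eq (map alpha (index_enum 'I_n)) r by apply: prod_XsubC_eq; rewrite e.
by congr (_ * _); rewrite -(perm_big _ rP) big_map.
Qed.

(* Main.v *)
Require Import Defs.
From mathcomp Require Import all_boot all_order all_algebra.
From mathcomp Require Import all_classical all_reals all_analysis.
From mathcomp Require Import perm mxpoly ring lra zify.
Import Order.TTheory GRing.Theory Num.Theory.
Import numFieldNormedType.Exports.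

Set Implicit Arguments.
Unset Strict Implicit.
Unset Printing Implicit Defensive.

Local Open Scope classical_set_scope.
Local Open Scope ring_scope.

(** Pritsker's energy argument, with the areas and the Dirichlet integral
    replaced by finite sums. Let [z_k] be the nonzero zeros and [sigma] the sum
    of the [delta_(z_k)] minus [N] times [mu_D]. In polar coordinates the
    logarithmic kernel is diagonal in the angle: its [m]-th Fourier mode is
    [(min / max)^m / m] in the two radii, and [- ln max] for [m = 0]. Sampling
    [phi] on circles at the [G]-th roots of unity, Abel summation along the
    radius and the inequality of the arithmetic and geometric means in each
    mode bound [2 sum phi d sigma] by [lam E + A^2 r^2 / lam] for every
    [lam > 0], where [E] is the energy of [sigma]; Bessel's inequality turns the
    Lipschitz condition into the term [A^2 r^2], half of it coming from the
    radial and half from the angular increments.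

    To make [E] finite the [m]-th mode is damped by [rho^m], a Poisson smoothing
    of [phi] on circles, with [1 - rho = 1 / (8 n)]. Since
    [|1 - rho^2 zeta| >= rho |1 - zeta|] for [|zeta| <= 1], this changes the
    off-diagonal terms by at most [- ln rho], and each diagonal term becomes
    [- ln |z_k| - ln (1 - rho^2)]. The resultant of the polynomial and its
    derivative is a nonzero integer, as is the constant coefficient, so that
    [E <= 2 n ln M(P) + n ln (8 n) + O(n)]. *)

(** * Monotonicity from quadratic increments *)

(** Write L for ln max(n, M(P)). Optimizing over [lam] turns the energy inequality into the bound A
    r sqrt(E). The energy costs 2 n L through the Mahler measure and another n L through the ln(8 n)
    of the diagonal; with the lower order terms E is at most 3.66 n L, and sqrt(3.66) is below
    1.914. What remains up to the factor 2 pays for the grid losses and for the zeros with |z_k| >=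
    3. The summand 1 in 2 R + 1 pays for the smoothing error at the other zeros, which is of order A
    sqrt(n) in total, and for a possible zero at the origin, where the kernel is infinite and which
    is therefore divided out beforehand. Since phi is merely Lipschitz, the Fourier coefficients
    need not be differentiable in the radius. Monotonicity along the radius is therefore derived
    from increments bounded by a constant times the square of the step; the constant may be
    arbitrarily large, because it disappears under refinement. *)

Lemma nonincreasing_of_quadratic_increments (R : realType) (G : R -> R) (a b K : R) :
  a <= b ->
  (forall x y, a <= x -> x <= y -> y <= b -> G y - G x <= K * (y - x) ^+ 2) ->
  G b <= G a.
Proof.
move=> ab H; rewrite leNgt; apply/negP => Gab.
pose e := G b - G a; have e0 : 0 < e by rewrite subr_gt0.
(* Over [N.+1] equal pieces the quadratic errors add up to K (b - a)^2 / (N + 1), while the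
   telescoping sum remains [e]. *)
have main (N : nat) : e * N.+1%:R <= K * (b - a) ^+ 2.
  pose h := (b - a) / N.+1%:R.
  have N0 : (0 : R) < N.+1%:R by rewrite ltr0n.
  have h0 : 0 <= h by rewrite divr_ge0 ?subr_ge0 // ltW.
  have bE : b = a + h * N.+1%:R by rewrite /h divfK ?lt0r_neq0 // addrC subrK.
  have -> : e = \sum_(0 <= i < N.+1) (G (a + h * i.+1%:R) - G (a + h * i%:R)).
    by rewrite (telescope_sumr (fun i => G (a + h * i%:R))) // mulr0 addr0 -bE.
  have -> : K * (b - a) ^+ 2 = (\sum_(0 <= i < N.+1) K * h ^+ 2) * N.+1%:R.
    rewrite big_const_nat iter_addr_0 subn0 -mulr_natr bE; ring.
  rewrite ler_pM2r // big_nat [X in _ <= X]big_nat; apply: ler_sum => i /andP[_ iN].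
  have -> : K * h ^+ 2 = K * ((a + h * i.+1%:R) - (a + h * i%:R)) ^+ 2.
    by rewrite -natr1; ring.
  apply: H; first by rewrite lerDl mulr_ge0.
    by rewrite lerD2l ler_wpM2l // ler_nat.
  by rewrite [leRHS]bE lerD2l ler_wpM2l // ler_nat.
have [N hN] : exists N : nat, K * (b - a) ^+ 2 / e < N%:R.
  exists (Num.truncn (K * (b - a) ^+ 2 / e)).+1; exact: truncnS_gt.
have := main N; rewrite leNgt => /negP; apply.
rewrite -ltr_pdivrMl // mulrC; apply: lt_le_trans hN _.
by rewrite ler_nat.
Qed.

(** Induction on the nodes: one strictly inside the interval splits it in two, any other imposes no
    condition. The nodes will be the radii of the charges and [r], where the increment formulas
    change. *)
Lemma nonincreasing_across_nodes (R : realType) (Z : seq R) (G : R -> R) (a b : R) :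
  a <= b ->
  (forall x y, a <= x -> x < y -> y <= b ->
     (forall z, z \in Z -> (z <= x) || (y <= z)) -> G y <= G x) ->
  G b <= G a.
Proof.
move=> ab; elim: Z => [|z Z IH] H.
  move: ab; rewrite le_eqVlt => /predU1P[-> //|ab].
  by apply: H => //; rewrite ?lexx.
apply: IH => x y ax xy yb Hz.
have [/andP[xz zy]|zxy] := boolP ((x < z) && (z < y)).
  apply: (@le_trans _ _ (G z)).
    apply: H => //; first by rewrite (le_trans ax) // ltW.
    move=> t; rewrite inE => /predU1P[->|tZ]; first by rewrite lexx.
    by case/orP: (Hz _ tZ) => h; [rewrite (le_trans h) // ltW | rewrite h orbT].
  apply: H => //; first by rewrite (le_trans _ yb) // ltW.
  move=> t; rewrite inE => /predU1P[->|tZ]; first by rewrite lexx orbT.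
  case/orP: (Hz _ tZ) => h; first by rewrite h.
  by rewrite (le_trans (ltW zy) h) orbT.
apply: H => // t; rewrite inE => /predU1P[->|tZ]; last exact: Hz.
by move: zxy; rewrite negb_and -!leNgt.
Qed.

(* [c = e^(-y)] turns the two bounds into [sinh (m y) >= m sinh y] and
   [tanh (m y / 2) <= m tanh (y / 2)]. *)
Lemma geometric_sinh_tanh (R : realType) (c : R) (m : nat) : 0 < c -> c <= 1 ->
  m%:R * (c^-1 - c) <= (c ^+ m)^-1 - c ^+ m /\
  (1 - c ^+ m) * (1 + c) <= m%:R * (1 - c) * (1 + c ^+ m).
Proof.
move=> c0 c1; elim: m => [|m [IH1 IH2]].
  by rewrite expr0 invr1; split; rewrite !mul0r ?subrr // mul0r.
have cm0 : 0 < c ^+ m by rewrite exprn_gt0.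
have cm1 : c ^+ m <= 1 by rewrite exprn_ile1 // ltW.
split.
- rewrite -natr1 mulrDl mul1r exprS invfM.
  set d := c ^+ m in IH1 cm0 cm1 *; set u := c^-1 in IH1 *; set v := d^-1 in IH1 *.
  have cu : c * u = 1 by rewrite divff // lt0r_neq0.
  have dv : d * v = 1 by rewrite divff // lt0r_neq0.
  have u1 : 1 <= u by rewrite invf_ge1.
  have v1 : 1 <= v by rewrite invf_ge1.
  clearbody u v d; move: (m%:R) IH1 => k IH1.
  have h1 : 1 - c <= u - 1 by nra.
  have h2 : 1 - d <= v - 1 by nra.
  have : (1 - c) * (1 - d) <= (u - 1) * (v - 1) by apply: ler_pM; rewrite ?subr_ge0.
  nra.
- rewrite -natr1 exprS.
  have mR : (0 : R) <= m%:R by rewrite ler0n.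
  set d := c ^+ m in IH2 cm0 cm1 *.
  have h1 : (1 - c * d) * (1 + c) * (1 + d) <= ((m%:R + 1) * (1 - c)) * (1 + c * d) * (1 + d).
    have h2 : (1 - d) * (1 + c) * (1 + c * d) <= m%:R * (1 - c) * (1 + d) * (1 + c * d).
      by rewrite ler_wpM2r //; nra.
    have h3 : (1 - c * d) * (1 + c) * (1 + d) <=
              (1 - d) * (1 + c) * (1 + c * d) + (1 - c) * (1 + c * d) * (1 + d).
      have -> : (1 - d) * (1 + c) * (1 + c * d) + (1 - c) * (1 + c * d) * (1 + d)
         = (1 - c * d) * (1 + c) * (1 + d)
           + (1 - c) * (1 - d) * (1 - c * d) by ring.
      rewrite lerDl !mulr_ge0 ?subr_ge0 // mulr_ile1 // ltW //.
    nra.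
  by rewrite ler_pM2r in h1 => //; lra.
Qed.

(** * The radial energy inequality *)

(** Put c = e^(-t). The left side plus m/2 (F'^2 - F^2) is half the minimum of the integral of f'^2
    + m^2 f^2 over [0, t] with end values F and F', that is, half the Dirichlet energy of the m-th
    mode in an annulus. It equals m / (2 sinh(m t)) (F' - F)^2 + m/2 tanh(m t / 2) (F^2 + F'^2), and
    [geometric_sinh_tanh] replaces both coefficients by ones whose sums over the modes are
    controlled by Bessel's inequality. *)
Lemma exponential_step_energy (R : realType) (m : nat) (c F F' : R) :
  (0 < m)%N -> 0 < c -> c < 1 ->
  m%:R * (c ^+ m * F' - F) ^+ 2 / (1 - (c ^+ m) ^+ 2) <=
  (F' - F) ^+ 2 / (2 * (1 - c)) + m%:R / 2 * (F ^+ 2 - F' ^+ 2)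
  + m%:R ^+ 2 / 2 * ((1 - c) / (1 + c)) * (F ^+ 2 + F' ^+ 2).
Proof.
move=> m0 c0 c1; have [sinhP tanhP] := geometric_sinh_tanh m c0 (ltW c1).
have d0 : 0 < c ^+ m by rewrite exprn_gt0.
have d1 : c ^+ m < 1 by rewrite exprn_ilt1 // ?ltW // -lt0n.
have mR : (0 : R) < m%:R by rewrite ltr0n.
move: (m%:R) mR sinhP tanhP => k k0; set d := c ^+ m in d0 d1 *.
clearbody d; move=> sinhP tanhP.
have w0 : 0 < 1 - d ^+ 2 by nra.
have -> : k * (d * F' - F) ^+ 2 / (1 - d ^+ 2) =
    (k * d / (1 - d ^+ 2)) * (F' - F) ^+ 2 + k / 2 * (F ^+ 2 - F' ^+ 2)
    + k / 2 * ((1 - d) / (1 + d)) * (F ^+ 2 + F' ^+ 2).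
  by field; rewrite !lt0r_neq0 //; nra.
apply: lerD; first apply: lerD => //.
  rewrite mulrC ler_wpM2l ?sqr_ge0 // ler_pdivrMr // [leRHS]mulrC ler_pdivlMr; last lra.
  have dv : d * d^-1 = 1 by rewrite divff // lt0r_neq0.
  have cv : c * c^-1 = 1 by rewrite divff // lt0r_neq0.
  have c1' : 1 < c^-1 by rewrite invf_gt1.
  move: (d^-1) (c^-1) dv cv c1' sinhP => v u dv cv c1' sinhP.
  have h1 : 2 * (1 - c) <= u - c by nra.
  have h2 : k * (2 * (1 - c)) <= v - d by apply: le_trans sinhP; rewrite ler_wpM2l // ltW.
  have : d * (k * (2 * (1 - c))) <= d * (v - d) by rewrite ler_wpM2l // ltW.
  nra.
rewrite ler_wpM2r ?addr_ge0 ?sqr_ge0 //.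
have -> : k ^+ 2 / 2 * ((1 - c) / (1 + c)) = k / 2 * (k * (1 - c) / (1 + c)).
  by field; lra.
have k2 : 0 <= k / 2 by lra.
rewrite ler_wpM2l // ler_pdivrMr; last lra.
by rewrite mulrAC ler_pdivlMr //; lra.
Qed.

(** [S] stands for the charge of the mode inside the circle. The arithmetic-geometric mean
    inequality with weight [lam] separates it from the increment of F t^(-m), and the square that it
    leaves is four times the left side of [exponential_step_energy]. *)
Lemma mode_increment (R : realType) (m : nat) (x y lam p S F F' : R) :
  (0 < m)%N -> 0 < x -> x < y -> 0 < lam ->
  - (4 * p * S * (F' * y ^- m - F * x ^- m)) <=
  lam * (p ^+ 2 / m%:R * (S ^+ 2 * ((x ^- m) ^+ 2 - (y ^- m) ^+ 2))) +
  lam^-1 * (2 * (F' - F) ^+ 2 * (y / (y - x)) + 2 * m%:R * (F ^+ 2 - F' ^+ 2)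
            + 2 * (m%:R ^+ 2 * (F ^+ 2 + F' ^+ 2)) * ((y - x) / (x + y))).
Proof.
move=> m0 x0 xy lam0.
have y0 : 0 < y by exact: lt_trans xy.
have c0 : 0 < x / y by rewrite divr_gt0.
have c1 : x / y < 1 by rewrite ltr_pdivrMr // mul1r.
have := exponential_step_energy F F' m0 c0 c1.
have d1 : (x / y) ^+ m < 1 by rewrite exprn_ilt1 // ?ltW // -lt0n.
have d0 : 0 < (x / y) ^+ m by rewrite exprn_gt0.
have yE : y ^- m = x ^- m * (x / y) ^+ m.
  by rewrite expr_div_n mulrA mulVf ?mul1r // lt0r_neq0 // exprn_gt0.
have mR : (0 : R) < m%:R by rewrite ltr0n.
rewrite yE; move: (x ^- m) ((x / y) ^+ m) d0 d1 (m%:R) mR => X d d0 d1 k k0 {yE}.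
have -> : 2 * (F' - F) ^+ 2 * (y / (y - x)) = 4 * ((F' - F) ^+ 2 / (2 * (1 - x / y))).
  by field; rewrite !lt0r_neq0 //; lra.
have -> : (1 - x / y) / (1 + x / y) = (y - x) / (x + y).
  by field; rewrite !lt0r_neq0 //; lra.
have -> : 2 * (k ^+ 2 * (F ^+ 2 + F' ^+ 2)) * ((y - x) / (x + y))
   = 4 * (k ^+ 2 / 2 * ((y - x) / (x + y)) * (F ^+ 2 + F' ^+ 2)).
  by field; rewrite !lt0r_neq0 //; lra.
have -> : 2 * k * (F ^+ 2 - F' ^+ 2) = 4 * (k / 2 * (F ^+ 2 - F' ^+ 2)).
  by field.
move: (_ / (2 * _)) (k / 2 * _) (k ^+ 2 / 2 * _ * _) => u v w H.
apply: (@le_trans _ _ (lam * (p ^+ 2 / k * (S ^+ 2 * (X ^+ 2 - (X * d) ^+ 2))) +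
  lam^-1 * (4 * (k * (d * F' - F) ^+ 2 / (1 - d ^+ 2))))); last first.
  have il0 : 0 <= lam^-1 by rewrite invr_ge0 ltW.
  by rewrite lerD2l ler_wpM2l //; lra.
have w0 : 0 < 1 - d ^+ 2 by nra.
rewrite -subr_ge0.
have -> : lam * (p ^+ 2 / k * (S ^+ 2 * (X ^+ 2 - (X * d) ^+ 2))) +
  lam^-1 * (4 * (k * (d * F' - F) ^+ 2 / (1 - d ^+ 2))) -
  - (4 * p * S * (F' * (X * d) - F * X)) =
  (lam * p * S * X * (1 - d ^+ 2) + 2 * k * (d * F' - F)) ^+ 2
   / (lam * k * (1 - d ^+ 2)).
  by field; rewrite !lt0r_neq0 //; nra.
by rewrite divr_ge0 ?sqr_ge0 // ltW // !mulr_gt0.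
Qed.

(** The case m = 0, where ln y - ln x >= (y - x) / y yields the same weight y / (y - x) as in the
    other modes. *)
Lemma log_mode_increment (R : realType) (x y lam S F F' : R) :
  0 < x -> x < y -> 0 < lam ->
  - (2 * S * (F' - F)) <=
  lam * (S ^+ 2 * (ln y - ln x)) + lam^-1 * ((F' - F) ^+ 2 * (y / (y - x))).
Proof.
move=> x0 xy lam0; have y0 : 0 < y by exact: lt_trans xy.
have lnyx : (y - x) / y <= ln y - ln x.
  have -> : ln y - ln x = - ln (x / y) by rewrite ln_div ?posrE // opprB.
  have -> : x / y = 1 + - ((y - x) / y) by field; rewrite lt0r_neq0.
  rewrite lerNr le_ln1Dx // ltrN2 ltr_pdivrMr // mul1r; lra.
have b0 : 0 < (y - x) / y by rewrite divr_gt0 // subr_gt0.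
have -> : y / (y - x) = ((y - x) / y)^-1 by rewrite invf_div.
move: (_ / y) (ln y - ln x) lnyx b0 => b l bl b0.
apply: (@le_trans _ _ (lam * (S ^+ 2 * b) + lam^-1 * ((F' - F) ^+ 2 * b^-1))); last first.
  by rewrite lerD2r !ler_wpM2l ?sqr_ge0 // ltW.
rewrite -subr_ge0.
have -> : lam * (S ^+ 2 * b) + lam^-1 * ((F' - F) ^+ 2 * b^-1) - - (2 * S * (F' - F))
  = (lam * S * b + (F' - F)) ^+ 2 / (lam * b).
  by field; rewrite !lt0r_neq0.
by rewrite divr_ge0 ?sqr_ge0 // ltW // mulr_gt0.
Qed.

Definition clamped_sum (R : realType) (K : finType) (rad c : K -> R) (f : R -> R) (s : R) : R :=
  \sum_k c k * f (Num.max (rad k) s).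

Definition clamped_form (R : realType) (K : finType) (rad c : K -> R) (f : R -> R) (s : R) : R :=
  \sum_k \sum_l c k * c l * f (Num.max (Num.max (rad k) (rad l)) s).

(* Clamping the radii at [s] truncates the radial integrals at [s]: between two
   consecutive nodes these sums only see the charge inside the circle. *)
Lemma clamped_sum_increment (R : realType) (K : finType) (rad c : K -> R)
    (f : R -> R) (x y : R) :
  x < y -> (forall k, (rad k <= x) || (y <= rad k)) ->
  clamped_sum rad c f y - clamped_sum rad c f x =
  (\sum_(k | rad k <= x) c k) * (f y - f x).
Proof.
move=> xy H; rewrite /clamped_sum -sumrB mulr_suml [RHS]big_mkcond /=.
apply: eq_bigr => k _; rewrite -mulrBr.
case: (leP (rad k) x) => [kx|xk]; first by rewrite max_r // (le_trans kx) // ltW.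
have := H k; rewrite leNgt xk /= => yk.
by rewrite !max_l ?subrr ?mulr0 // ltW.
Qed.

Lemma clamped_form_increment (R : realType) (K : finType) (rad c : K -> R)
    (f : R -> R) (x y : R) :
  x < y -> (forall k, (rad k <= x) || (y <= rad k)) ->
  clamped_form rad c f y - clamped_form rad c f x =
  (\sum_(k | rad k <= x) c k) ^+ 2 * (f y - f x).
Proof.
move=> xy H; rewrite /clamped_form -sumrB expr2 mulr_suml mulr_suml [RHS]big_mkcond /=.
apply: eq_bigr => k _; rewrite -sumrB.
case: (leP (rad k) x) => [kx|xk]; last first.
  have := H k; rewrite leNgt xk /= => yk; apply: big1 => l _.
  have my : y <= Num.max (rad k) (rad l) by rewrite le_max yk.
  by rewrite (max_l my) (max_l (le_trans (ltW xy) my)) subrr.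
rewrite mulr_sumr mulr_suml [RHS]big_mkcond /=; apply: eq_bigr => l _; rewrite -mulrBr.
case: (leP (rad l) x) => [lx|xl].
  have mx : Num.max (rad k) (rad l) <= x by rewrite ge_max kx.
  by rewrite (max_r mx) (max_r (le_trans mx (ltW xy))).
have := H l; rewrite leNgt xl /= => yl.
have my : y <= Num.max (rad k) (rad l) by rewrite le_max yl orbT.
by rewrite (max_l my) (max_l (le_trans (ltW xy) my)) subrr mulr0.
Qed.

Lemma clamped_sum_low (R : realType) (K : finType) (rad c : K -> R) (f : R -> R) (s : R) :
  (forall k, s <= rad k) -> clamped_sum rad c f s = \sum_k c k * f (rad k).
Proof. by move=> H; apply: eq_bigr => k _; rewrite max_l. Qed.

Lemma clamped_sum_high (R : realType) (K : finType) (rad c : K -> R) (f : R -> R) (s : R) :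
  (forall k, rad k <= s) -> clamped_sum rad c f s = (\sum_k c k) * f s.
Proof. by move=> H; rewrite mulr_suml; apply: eq_bigr => k _; rewrite max_r. Qed.

Lemma clamped_form_low (R : realType) (K : finType) (rad c : K -> R) (f : R -> R) (s : R) :
  (forall k, s <= rad k) ->
  clamped_form rad c f s = \sum_k \sum_l c k * c l * f (Num.max (rad k) (rad l)).
Proof.
move=> H; apply: eq_bigr => k _; apply: eq_bigr => l _.
by rewrite max_l // le_max H.
Qed.

Lemma clamped_form_high (R : realType) (K : finType) (rad c : K -> R) (f : R -> R) (s : R) :
  (forall k, rad k <= s) -> clamped_form rad c f s = (\sum_k c k) ^+ 2 * f s.
Proof.
move=> H; rewrite expr2 !mulr_suml; apply: eq_bigr => k _.
rewrite mulr_sumr mulr_suml; apply: eq_bigr => l _.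
by rewrite max_r // ge_max !H.
Qed.

Section RadialEnergy.
Variables (R : realType) (K J : finType) (rad c : K -> R) (m : J -> nat)
  (p : J -> R) (w : J -> K -> R) (F0 : R -> R) (F : J -> R -> R) (A r lam : R).
Hypotheses (r_gt0 : 0 < r) (lam_gt0 : 0 < lam) (rad_gt0 : forall k, 0 < rad k)
  (m_gt0 : forall j, (0 < m j)%N) (c_neutral : \sum_k c k = 0).
Hypothesis F_incr : forall x y : R, 0 < x -> x < y ->
  (F0 y - F0 x) ^+ 2 + 2 * \sum_j (F j y - F j x) ^+ 2 <= A ^+ 2 * (y - x) ^+ 2.
Hypothesis F_angular : forall x : R, 0 < x ->
  2 * \sum_j (m j)%:R ^+ 2 * F j x ^+ 2 <= A ^+ 2 * x ^+ 2.
Hypothesis F_supp : forall x, r <= x -> F0 x = 0 /\ forall j, F j x = 0.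

(* The claimed inequality truncated at radius [s]. The summand
   [2 m F_j(s)^2] carries the cross terms [m F_j F_j'] of the completed squares,
   which are exact derivatives. *)
Let G (s : R) : R :=
  - (2 * clamped_sum rad c F0 s)
  - \sum_j 4 * p j * clamped_sum rad (w j) (fun t => F j t * t ^- m j) s
  - lam * (clamped_form rad c (@ln R) s
           - \sum_j p j ^+ 2 / (m j)%:R * clamped_form rad (w j) (fun t => (t ^- m j) ^+ 2) s)
  + lam^-1 * (\sum_j 2 * (m j)%:R * F j s ^+ 2 - A ^+ 2 * Num.min s r ^+ 2).

(** Between nodes the charge terms of [G] cancel those of the mode bounds, and the increment of 2 m
    F_j^2 cancels their cross terms. Only increments and values of the coefficients of phi survive,
    and no charge. *)
Let G_increment (x y : R) : 0 < x -> x < y ->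
  (forall k, (rad k <= x) || (y <= rad k)) ->
  G y - G x <= lam^-1 * (((F0 y - F0 x) ^+ 2 + 2 * \sum_j (F j y - F j x) ^+ 2) * (y / (y - x))
    + (2 * \sum_j (m j)%:R ^+ 2 * F j x ^+ 2 + 2 * \sum_j (m j)%:R ^+ 2 * F j y ^+ 2)
       * ((y - x) / (x + y))
    - A ^+ 2 * (Num.min y r ^+ 2 - Num.min x r ^+ 2)).
Proof.
move=> x0 xy H.
pose S0 := \sum_(k | rad k <= x) c k.
pose S j := \sum_(k | rad k <= x) w j k.
have -> : G y - G x =
  - (2 * S0 * (F0 y - F0 x)) - lam * (S0 ^+ 2 * (ln y - ln x))
  + \sum_j (- (4 * p j * S j * (F j y * y ^- m j - F j x * x ^- m j))
        - lam * (p j ^+ 2 / (m j)%:R * (S j ^+ 2 * ((x ^- m j) ^+ 2 - (y ^- m j) ^+ 2)))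
        - lam^-1 * (2 * (m j)%:R * (F j x ^+ 2 - F j y ^+ 2)))
  - lam^-1 * (A ^+ 2 * (Num.min y r ^+ 2 - Num.min x r ^+ 2)).
  rewrite -(clamped_form_increment c (@ln R) xy H).
  have -> : 2 * S0 * (F0 y - F0 x) = 2 * (clamped_sum rad c F0 y - clamped_sum rad c F0 x).
    by rewrite (clamped_sum_increment c F0 xy H) mulrA.
  have -> : \sum_j (- (4 * p j * S j * (F j y * y ^- m j - F j x * x ^- m j))
        - lam * (p j ^+ 2 / (m j)%:R * (S j ^+ 2 * ((x ^- m j) ^+ 2 - (y ^- m j) ^+ 2)))
        - lam^-1 * (2 * (m j)%:R * (F j x ^+ 2 - F j y ^+ 2)))
    = \sum_j (- (4 * p j * clamped_sum rad (w j) (fun t => F j t * t ^- m j) y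
        - 4 * p j * clamped_sum rad (w j) (fun t => F j t * t ^- m j) x)
    + lam * (p j ^+ 2 / (m j)%:R * clamped_form rad (w j) (fun t => (t ^- m j) ^+ 2) y
        - p j ^+ 2 / (m j)%:R * clamped_form rad (w j) (fun t => (t ^- m j) ^+ 2) x)
    + lam^-1 * (2 * (m j)%:R * F j y ^+ 2 - 2 * (m j)%:R * F j x ^+ 2)).
    apply: eq_bigr => j _; rewrite -!mulrBr.
    rewrite (clamped_sum_increment (w j) (fun t => F j t * t ^- m j) xy H).
    rewrite (clamped_form_increment (w j) (fun t => (t ^- m j) ^+ 2) xy H).
    rewrite -/(S j); ring.
  by rewrite !big_split /= sumrN -!mulr_sumr !sumrB /G; ring.
have hj : \sum_j (- (4 * p j * S j * (F j y * y ^- m j - F j x * x ^- m j))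
        - lam * (p j ^+ 2 / (m j)%:R * (S j ^+ 2 * ((x ^- m j) ^+ 2 - (y ^- m j) ^+ 2)))
        - lam^-1 * (2 * (m j)%:R * (F j x ^+ 2 - F j y ^+ 2)))
   <= \sum_j lam^-1 * (2 * (F j y - F j x) ^+ 2 * (y / (y - x))
            + 2 * ((m j)%:R ^+ 2 * (F j x ^+ 2 + F j y ^+ 2)) * ((y - x) / (x + y))).
  apply: ler_sum => j _.
  have := mode_increment (p j) (S j) (F j x) (F j y) (m_gt0 j) x0 xy lam_gt0; lra.
have h0 := log_mode_increment S0 (F0 x) (F0 y) x0 xy lam_gt0.
apply: (@le_trans _ _ (lam^-1 * ((F0 y - F0 x) ^+ 2 * (y / (y - x)))
  + \sum_j lam^-1 * (2 * (F j y - F j x) ^+ 2 * (y / (y - x))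
            + 2 * ((m j)%:R ^+ 2 * (F j x ^+ 2 + F j y ^+ 2)) * ((y - x) / (x + y)))
  - lam^-1 * (A ^+ 2 * (Num.min y r ^+ 2 - Num.min x r ^+ 2)))); first lra.
rewrite -mulr_sumr big_split /= -!mulr_suml -!mulr_sumr.
under [X in 2 * X * ((y - x) / (x + y))]eq_bigr do rewrite mulrDr.
rewrite big_split /= -subr_ge0.
rewrite [X in 0 <= X](_ : _ = 0) //; ring.
Qed.

(** Beyond [r] the coefficients vanish and [Num.min s r] is constant. Below [r] the radial and the
    angular increments each contribute at most A^2 t (t - s), which the increment of A^2 s^2
    compensates up to a quadratic error. *)
Let G_noninc (x y : R) : 0 < x -> x <= y -> G y <= G x.
Proof.
move=> x0 xy.
apply: (@nonincreasing_across_nodes R (r :: [seq rad k | k <- enum K])) => //.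
move=> a b xa ab by_ Hz.
have a0 : 0 < a by exact: lt_le_trans xa.
have Hk k : (rad k <= a) || (b <= rad k).
  by apply: Hz; rewrite inE map_f ?orbT // mem_enum.
have /orP[ra|br] := Hz r (mem_head _ _).
  have Hb : r <= b by rewrite (le_trans ra) // ltW.
  rewrite -subr_le0; apply: le_trans (G_increment a0 ab Hk) _.
  have [-> Fa] := F_supp ra; have [-> Fb] := F_supp Hb.
  rewrite !big1; do ?by move=> j _; rewrite ?Fa ?Fb ?subrr ?expr0n ?mulr0.
  by rewrite !min_r // !subrr !mulr0 addr0 expr0n /= add0r !mul0r addr0 subrr mulr0.
apply: (@nonincreasing_of_quadratic_increments R G a b (lam^-1 * A ^+ 2)).
  exact: ltW.
move=> s t as_ st tb.
have [->|st'] := eqVneq s t; first by rewrite !subrr expr0n mulr0.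
have {st'}st : s < t by rewrite lt_neqAle st'.
have s0 : 0 < s by exact: lt_le_trans as_.
have t0 : 0 < t by exact: lt_trans st.
have Hst k : (rad k <= s) || (t <= rad k).
  case/orP: (Hk k) => h; first by rewrite (le_trans h).
  by rewrite (le_trans tb h) orbT.
apply: le_trans (G_increment s0 st Hst) _.
have tr : t <= r by exact: le_trans br.
have sr : s <= r by rewrite (le_trans _ tr) // ltW.
have il : 0 <= lam^-1 by rewrite invr_ge0 ltW.
rewrite !min_l // -[leRHS]mulrA; apply: ler_wpM2l => //.
have b1 : 0 <= t / (t - s) by rewrite divr_ge0 ?subr_ge0 // ltW.
have b2 : 0 <= (t - s) / (s + t) by rewrite divr_ge0 ?subr_ge0 ?addr_ge0 // ltW.
have h1 := ler_wpM2r b1 (F_incr s0 st).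
have h2 := ler_wpM2r b2 (lerD (F_angular s0) (F_angular t0)).
apply: le_trans (lerB (lerD h1 h2) (lexx _)) _.
have -> : A ^+ 2 * (t - s) ^+ 2 * (t / (t - s)) = A ^+ 2 * ((t - s) * t).
  by field; rewrite lt0r_neq0 // subr_gt0.
have h3 : (A ^+ 2 * s ^+ 2 + A ^+ 2 * t ^+ 2) * ((t - s) / (s + t)) <= A ^+ 2 * ((t - s) * t).
  have -> : (A ^+ 2 * s ^+ 2 + A ^+ 2 * t ^+ 2) * ((t - s) / (s + t)) =
    A ^+ 2 * ((t - s) * ((s ^+ 2 + t ^+ 2) / (s + t))).
    by field; rewrite lt0r_neq0 // addr_gt0.
  rewrite !ler_wpM2l ?sqr_ge0 ?subr_ge0 //; first exact: ltW.
  rewrite ler_pdivrMr ?addr_gt0 //; nra.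
apply: le_trans (lerB (lerD (lexx _) h3) (lexx _)) _.
(* 2 t (t - s) - (t^2 - s^2) = (t - s)^2. *)
rewrite -subr_ge0 [X in 0 <= X](_ : _ = 0) //; ring.
Qed.

(** [G] is compared at a radius [s] below all charges, where the clamped sums are the full ones, and
    at a radius [t] beyond all charges and beyond [r], where neutrality removes the logarithm and
    the support condition removes the linear terms. *)
Lemma radial_energy_bound :
  2 * \sum_k c k * F0 (rad k)
  + 4 * \sum_j p j * \sum_k w j k * (F j (rad k) * rad k ^- m j) <=
  lam * (- (\sum_k \sum_l c k * c l * ln (Num.max (rad k) (rad l)))
         + \sum_j p j ^+ 2 / (m j)%:R *
             \sum_k \sum_l w j k * w j l * (Num.max (rad k) (rad l) ^- m j) ^+ 2)
  + lam^-1 * (A ^+ 2 * r ^+ 2).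
Proof.
pose s := \big[Num.min/r]_k rad k; pose t := \big[Num.max/r]_k rad k.
have s0 : 0 < s by rewrite /s; apply: (big_ind (fun v => 0 < v)) => // a b a0 b0; rewrite lt_min a0.
have sk k : s <= rad k by rewrite /s; exact: bigmin_le.
have tk k : rad k <= t by rewrite /t; exact: le_bigmax.
have sr : s <= r by rewrite /s; exact: bigmin_le_id.
have rt : r <= t by rewrite /t; exact: bigmax_ge_id.
have := G_noninc s0 (le_trans sr rt).
have [F0t Ft] := F_supp rt.
rewrite /G (clamped_sum_high c F0 tk) (clamped_form_high c (@ln R) tk).
rewrite (clamped_sum_low c F0 sk) (clamped_form_low c (@ln R) sk).
rewrite c_neutral expr0n /= !mul0r (min_r rt) (min_l sr) mulr0.
have -> : \sum_j 4 * p j * clamped_sum rad (w j) (fun t0 => F j t0 * t0 ^- m j) t = 0.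
  by apply: big1 => j _; rewrite clamped_sum_high // Ft mul0r !mulr0.
have -> : \sum_j 2 * (m j)%:R * F j t ^+ 2 = 0.
  by apply: big1 => j _; rewrite Ft expr0n mulr0.
(* The energy of the modes outside the circle of radius [t] has a favourable sign and is dropped. *)
have e1 : 0 <= \sum_j p j ^+ 2 / (m j)%:R *
    clamped_form rad (w j) (fun t0 => (t0 ^- m j) ^+ 2) t.
  apply: sumr_ge0 => j _; rewrite clamped_form_high //.
  by apply: mulr_ge0; apply: mulr_ge0; rewrite ?sqr_ge0 ?invr_ge0 ?ler0n.
have -> : \sum_j p j ^+ 2 / (m j)%:R * clamped_form rad (w j) (fun t0 => (t0 ^- m j) ^+ 2) s
  = \sum_j p j ^+ 2 / (m j)%:R *
     \sum_k \sum_l w j k * w j l * (Num.max (rad k) (rad l) ^- m j) ^+ 2.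
  by apply: eq_bigr => j _; rewrite clamped_form_low.
have -> : \sum_j 4 * p j * clamped_sum rad (w j) (fun t0 => F j t0 * t0 ^- m j) s
  = 4 * \sum_j p j * \sum_k w j k * (F j (rad k) * rad k ^- m j).
  by rewrite mulr_sumr; apply: eq_bigr => j _; rewrite clamped_sum_low // mulrA.
(* Because m <= m^2, the angular bound absorbs the boundary term at [s] into A^2 s^2. *)
have h2 : \sum_j 2 * (m j)%:R * F j s ^+ 2 <= A ^+ 2 * s ^+ 2.
  apply: le_trans (F_angular s0); rewrite mulr_sumr; apply: ler_sum => j _.
  rewrite -mulrA ler_wpM2l // ler_wpM2r ?sqr_ge0 //.
  by rewrite -natrX ler_nat -{1}(expn1 (m j)) leq_pexp2l.
have h3 := ler_wpM2l (ltW lam_gt0) e1; rewrite mulr0 in h3.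
have il : 0 <= lam^-1 by rewrite invr_ge0 ltW.
have h4 := ler_wpM2l il h2.
rewrite !sub0r !mulrBr !mulrDr !mulrN; lra.
Qed.

End RadialEnergy.

(** * Resultants and integer polynomials *)

(** Sends i < N to M + i and N + l to l: the powers below N, which form the Vandermonde block, are
    moved behind the M rows for the top coefficients, so that the matrix becomes block
    triangular. *)
Definition swap_blocks (M N : nat) (i : 'I_(M + N)) : 'I_(M + N) :=
  match fintype.split (cast_ord (addnC M N) i) with
  | inl k => rshift M k
  | inr l => lshift N l
  end.

Lemma swap_blocks_inj M N : injective (@swap_blocks M N).
Proof.
move=> i j; rewrite /swap_blocks.
case: splitP => k; case: splitP => l /= hl hk /(congr1 val) /= h; apply: val_inj => /=;
  have := ltn_ord k; have := ltn_ord l; lia.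
Qed.

(* The Sylvester matrix times the matrix sending the coefficients of [f] to
   its top [size q - 1] coefficients and its values at the roots of [p]. *)
Lemma resultant_roots (F : fieldType) (p q : {poly F}) (z : 'I_(size p).-1 -> F) :
  p != 0 -> injective z -> (forall k, p.[z k] = 0) ->
  exists b : bool,
    resultant p q = (-1) ^+ b * (lead_coef p ^+ (size q).-1 * \prod_k q.[z k]).
Proof.
move=> p0 zi pz.
set M := (size q).-1; set N := (size p).-1 in z zi pz *.
pose sg : 'S_(M + N) := perm (@swap_blocks_inj M N).
pose V : 'M[F]_N := Vandermonde N (\row_j z j).
pose C : 'M[F]_(M, N) := \matrix_(l, j) z j ^+ (N + l).
pose W : 'M[F]_(M + N) := row_perm sg (block_mx 1%:M C 0 V).
have WE (i : 'I_(M + N)) (c : 'I_(M + N)) :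
    W i c = match fintype.split c with inl l => ((i : nat) == N + l)%:R | inr j => z j ^+ i end.
  rewrite mxE permE /swap_blocks; case: splitP => k /= ik; case: splitP => l cl.
  - have -> : c = lshift N l by apply: val_inj.
    rewrite block_mxEdl mxE; case: eqP => // E.
    by have := ltn_ord k; rewrite -ik E; lia.
  - have -> : c = rshift M l by apply: val_inj.
    by rewrite block_mxEdr !mxE ik.
  - have -> : c = lshift N l by apply: val_inj.
    by rewrite block_mxEul mxE ik eqn_add2l.
  - have -> : c = rshift M l by apply: val_inj.
    by rewrite block_mxEur !mxE ik.
have detV : \det V != 0.
  rewrite det_Vandermonde; apply/prodf_neq0 => i _; apply/prodf_neq0 => j ij.
  by rewrite !mxE subr_eq0; apply: contraTneq ij => /zi ->; rewrite ltnn.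
have detW : \det W = (-1) ^+ sg * \det V.
  rewrite /W row_permE det_mulmx det_perm; congr (_ * _).
  by rewrite det_ublock det1 mul1r.
have sp : size p = N.+1 by rewrite prednK // size_poly_gt0.
have sq : (size q <= M.+1)%N by rewrite leqSpred.
pose A : 'M[F]_M := \matrix_(k, l) ('X^k * p)`_(N + l).
pose B : 'M[F]_(N, M) := \matrix_(k, l) ('X^k * q)`_(N + l).
have SW : Sylvester_mx p q *m W = block_mx A 0 B (V *m diag_mx (\row_j q.[z j])).
  apply/matrixP => i c; rewrite !mxE.
  have rowE (f : {poly F}) : (size f <= M + N)%N ->
      \sum_(j < M + N) f`_j * W j c =
      match fintype.split c with inl l => f`_(N + l) | inr j => f.[z j] end.
    move=> sf; case E : (fintype.split c) => [l|j].
      have hl : (N + l < M + N)%N by rewrite addnC ltn_add2r.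
      rewrite (bigD1 (Ordinal hl)) //= WE E eqxx mulr1 big1 ?addr0 // => j jl.
      rewrite WE E; case: eqP => [jE|]; last by rewrite mulr0.
      by case/eqP: jl; apply: val_inj.
    by rewrite (horner_coef_wide _ sf); apply: eq_bigr => k _; rewrite WE E.
  pose f : {poly F} := match fintype.split i with inl k => 'X^k * p | inr k => 'X^k * q end.
  have fE (j : 'I_(M + N)) : Sylvester_mx p q i j = f`_j.
    rewrite Sylvester_mxE /f.
    by case: (fintype.split i) => k; rewrite coefXnM ltnNge if_neg -mulrb.
  have sf : (size f <= M + N)%N.
    rewrite /f; case: (fintype.split i) => k; apply: leq_trans (size_polyMleq _ _) _; rewrite size_polyXn.
      by have : (k < M)%N := ltn_ord k; rewrite sp; lia.
    by have : (k < N)%N := ltn_ord k; lia.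
  under eq_bigr do rewrite fE.
  rewrite rowE // /f.
  case: (fintype.split i) => k; rewrite mxE; case: (fintype.split c) => l; rewrite !mxE //.
  - by rewrite hornerM pz mulr0.
  - rewrite (bigD1 l) //= !mxE eqxx mulr1n big1 ?addr0.
      by rewrite hornerM hornerXn.
    by move=> j jl; rewrite !mxE (negbTE jl) mulr0n mulr0.
have detA : \det A = lead_coef p ^+ M.
  rewrite det_trig.
    rewrite (eq_bigr (fun=> lead_coef p)) ?prodr_const ?card_ord // => l _.
    by rewrite mxE coefXnM lead_coefE sp /= ifF ?addnK // ltnNge leq_addl.
  apply/is_trig_mxP => k l kl; rewrite mxE coefXnM; case: ltnP => // _.
  by rewrite nth_default // sp; lia.
have := congr1 determinant SW; rewrite det_mulmx det_lblock detA detW det_mulmx det_diag.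
rewrite -/(resultant p q) => E; exists (sg : bool).
have {}E : resultant p q * (-1) ^+ sg = lead_coef p ^+ M * \prod_k q.[z k].
  apply: (mulIf detV); rewrite -mulrA E.
  rewrite (eq_bigr (fun k => q.[z k])); first by ring.
  by move=> k _; rewrite mxE.
by rewrite -E mulrCA -signr_addb addbb mulr1.
Qed.

(** * The modulus as a real number *)

Section Cmod.
Variable R : realType.
Implicit Types z w : R[i].

Lemma cmod_ge0 z : 0 <= cmod z.
Proof. by rewrite /cmod; case: z => a b /=; rewrite sqrtr_ge0. Qed.

Lemma cmod0 : cmod (0 : R[i]) = 0. Proof. exact: ComplexField.Normc.normc0. Qed.

Lemma cmod1 : cmod (1 : R[i]) = 1. Proof. exact: ComplexField.Normc.normc1. Qed.

Lemma cmodM z w : cmod (z * w) = cmod z * cmod w.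
Proof. exact: ComplexField.Normc.normcM. Qed.

Lemma cmodV z : cmod z^-1 = (cmod z)^-1.
Proof. exact: ComplexField.Normc.normcV. Qed.

Lemma cmodN z : cmod (- z) = cmod z.
Proof. by rewrite /cmod; case: z => a b /=; rewrite !sqrrN. Qed.

Lemma cmodB z w : cmod (z - w) = cmod (w - z).
Proof. by rewrite -cmodN opprB. Qed.

Lemma cmodX z n : cmod (z ^+ n) = cmod z ^+ n.
Proof. by elim: n => [|n IH]; rewrite ?expr0 ?cmod1 // !exprS cmodM IH. Qed.

Lemma cmod_sqr z : cmod z ^+ 2 = complex.Re z ^+ 2 + complex.Im z ^+ 2.
Proof. by rewrite /cmod; case: z => a b /=; rewrite sqr_sqrtr // addr_ge0 ?sqr_ge0. Qed.

Lemma cmod_real (x : R) : cmod x%:C%C = `|x|.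
Proof. by rewrite /cmod /= expr0n addr0 sqrtr_sqr. Qed.

Lemma cmod_eq0 z : (cmod z == 0) = (z == 0).
Proof.
apply/eqP/eqP => [|->]; last exact: cmod0.
exact: ComplexField.Normc.eq0_normc.
Qed.

Lemma cmod_gt0 z : (0 < cmod z) = (z != 0).
Proof. by rewrite lt_def cmod_ge0 andbT cmod_eq0. Qed.

Lemma cmodD z w : cmod (z + w) <= cmod z + cmod w.
Proof. by have := ler_normD z w; rewrite !cmodE -rmorphD lecR. Qed.

Lemma cmod_sum (I : Type) (s : seq I) (P : pred I) (f : I -> R[i]) :
  cmod (\sum_(i <- s | P i) f i) <= \sum_(i <- s | P i) cmod (f i).
Proof.
elim/big_ind2: _ => [|x y z w xy zw|//]; first by rewrite cmod0.
by apply: le_trans (cmodD _ _) (lerD _ _).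
Qed.

Lemma cmod_prod (I : Type) (s : seq I) (P : pred I) (f : I -> R[i]) :
  cmod (\prod_(i <- s | P i) f i) = \prod_(i <- s | P i) cmod (f i).
Proof. by apply: (big_morph (@cmod R)); [exact: cmodM | exact: cmod1]. Qed.

Lemma norm_Re_le_cmod z : `|complex.Re z| <= cmod z.
Proof.
rewrite -(@ler_pXn2r _ 2) ?nnegrE ?cmod_ge0 // real_normK ?num_real //.
by rewrite cmod_sqr lerDl sqr_ge0.
Qed.

Lemma cmod_conj z : cmod z^*%C = cmod z.
Proof. by rewrite /cmod; case: z => a b /=; rewrite sqrrN. Qed.

Lemma cmod_int_ge1 (k : int) : k != 0 -> 1 <= cmod (k%:~R : R[i]).
Proof.
move=> k0; have -> : (k%:~R : R[i]) = (k%:~R)%:C%C by rewrite rmorph_int.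
rewrite cmod_real -intr_norm -[1]/(1%:~R) ler_int.
by rewrite -gtz0_ge1 normr_gt0.
Qed.

End Cmod.

(* The library's [map_resultant] only covers morphisms out of [{poly _}]. *)
Lemma resultant_map_poly (aR rR : nzRingType) (f : {rmorphism aR -> rR}) (p q : {poly aR}) :
  f (lead_coef p) != 0 -> f (lead_coef q) != 0 ->
  resultant (map_poly f p) (map_poly f q) = f (resultant p q).
Proof.
move=> p0 q0; rewrite /resultant /Sylvester_mx !size_map_poly_id0 //.
rewrite -det_map_mx /= map_col_mx; congr (\det (col_mx _ _)).
  by symmetry; apply: map_lin1_mx => v; rewrite map_poly_rV rmorphM /= map_rVpoly.
by symmetry; apply: map_lin1_mx => v; rewrite map_poly_rV rmorphM /= map_rVpoly.
Qed.

Section IntegerPolynomial.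
Variables (R : realType) (N : nat) (Q : {poly int}) (a : R[i]) (z : 'I_N -> R[i]).
Hypotheses (a_neq0 : a != 0)
  (QE : map_poly intr Q = a *: \prod_(k < N) ('X - (z k)%:P)).

Let lead_map : lead_coef (map_poly intr Q : {poly R[i]}) = a.
Proof. by rewrite QE lead_coefZ (monicP (monic_prod_XsubC _ _ _)) mulr1. Qed.

Lemma cmod_lead_ge1 : 1 <= cmod a.
Proof.
have inj : injective (intr : int -> R[i]) by exact: intr_inj.
rewrite -lead_map lead_coef_map_inj // cmod_int_ge1 //.
rewrite lead_coef_eq0; apply: contra a_neq0 => /eqP Q0.
by rewrite -lead_map Q0 map_poly0 lead_coef0.
Qed.

(** The product is the modulus of the constant coefficient of [Q], a nonzero integer. *)
Lemma lead_prod_roots_ge1 : (forall k, z k != 0) -> 1 <= cmod a * \prod_k cmod (z k).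
Proof.
move=> z0; have E : (Q`_0)%:~R = a * \prod_k (- z k).
  rewrite -coef_map QE -horner_coef0 hornerZ horner_prod.
  by congr (_ * _); apply: eq_bigr => k _; rewrite hornerXsubC sub0r.
have -> : cmod a * \prod_k cmod (z k) = cmod (Q`_0)%:~R.
  rewrite E cmodM cmod_prod; congr (_ * _).
  by apply: eq_bigr => k _; rewrite cmodN.
apply: cmod_int_ge1; apply/eqP => Q0; move/eqP: E; rewrite Q0 eq_sym mulf_eq0 (negbTE a_neq0) /=.
by apply/negP; apply/prodf_neq0 => k _; rewrite oppr_eq0.
Qed.

Let size_map : size (map_poly intr Q : {poly R[i]}) = N.+1.
Proof. by rewrite QE size_scale // size_prod_XsubC /index_enum -enumT size_enum_ord. Qed.

(** The product is the modulus of the resultant of [Q] and its derivative. Of the exponent, N - 1 is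
    the degree of the derivative, and N comes from the factor [a] in each of the N values of the
    derivative at the roots. *)
Lemma lead_prod_differences_ge1 : injective z ->
  1 <= cmod a ^+ (N + N.-1) * \prod_k \prod_(l | l != k) cmod (z k - z l).
Proof.
move=> zi; set p : {poly R[i]} := map_poly intr Q.
have p0 : p != 0 by rewrite -size_poly_eq0 size_map.
have pr k : p.[z k] = 0.
  by rewrite /p QE hornerZ horner_prod (bigD1 k) //= hornerXsubC subrr mul0r mulr0.
have [N0|N0] := posnP N.
  rewrite big1 ?mulr1; last by move=> k; have := ltn_ord k; rewrite {2}N0.
  by rewrite N0 expr0.
have p'z k : p^`().[z k] = a * \prod_(l | l != k) (z k - z l).
  rewrite /p QE derivZ hornerZ (bigD1 k) //= derivM derivXsubC mul1r hornerD hornerM.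
  rewrite hornerXsubC subrr mul0r addr0 horner_prod; congr (_ * _).
  by apply: eq_bigr => l _; rewrite hornerXsubC.
have sz' : size p^`() = N.
  apply/eqP; rewrite eqn_leq; apply/andP; split.
    by rewrite -ltnS -[in leqRHS]size_map -/p lt_size_deriv.
  rewrite -(prednK N0) -[leqLHS]/(N.-1.+1) ltnNge; apply/negP => /leq_sizeP /(_ _ (leqnn _)).
  rewrite coef_deriv prednK // => /eqP; rewrite -mulr_natr mulf_eq0 pnatr_eq0 (gtn_eqF N0) orbF.
  by rewrite -[N]/(N.+1.-1) -size_map -/(lead_coef p) lead_map (negbTE a_neq0).
have spN : (size p).-1 = N by rewrite size_map.
pose zz (k : 'I_(size p).-1) := z (cast_ord spN k).
have [b E] : exists b : bool,
    resultant p p^`() = (-1) ^+ b * (lead_coef p ^+ (size p^`()).-1 * \prod_k p^`().[zz k]).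
  apply: resultant_roots => //; first by move=> k l /zi /cast_ord_inj.
  by move=> k; rewrite /zz pr.
have EZ : cmod (resultant p p^`()) = cmod a ^+ (N + N.-1) * \prod_k \prod_(l | l != k) cmod (z k - z l).
  rewrite E cmodM cmodX cmodN cmod1 expr1n mul1r sz' lead_map cmodM cmodX exprD mulrAC mulrC.
  congr (_ * _); rewrite cmod_prod.
  rewrite (reindex (cast_ord (esym spN))) /=; last first.
    by exists (cast_ord spN) => k _; rewrite ?cast_ordK ?cast_ordKV.
  rewrite (eq_bigr (fun k => cmod a * \prod_(l | l != k) cmod (z k - z l))); last first.
    by move=> k _; rewrite /zz cast_ordKV p'z cmodM cmod_prod.
  by rewrite big_split prodr_const card_ord.
have inj : injective (intr : int -> R[i]) by exact: intr_inj.
have Q0 : Q != 0.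
  by apply: contra p0 => /eqP Q0; rewrite /p Q0 map_poly0.
have Q'0 : Q^`() != 0.
  apply: contraTneq N0 => Q'0; rewrite -sz' /p deriv_map Q'0 map_poly0 size_poly0.
  by [].
have rE : (resultant Q Q^`())%:~R = resultant p p^`() :> R[i].
  by rewrite /p deriv_map resultant_map_poly // intr_eq0 lead_coef_eq0.
rewrite -EZ -rE; apply: cmod_int_ge1; apply/eqP => r0.
move: EZ; rewrite -rE r0 cmod0 => /esym/eqP; apply/negP.
rewrite mulf_neq0 ?expf_neq0 ?cmod_eq0 //.
apply/prodf_neq0 => k _; apply/prodf_neq0 => l lk.
by rewrite cmod_eq0 subr_eq0; apply: contraNneq lk => /zi ->.
Qed.

End IntegerPolynomial.

(** * The smoothed logarithmic kernel *)

Section LogKernel.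
Variable R : realType.
Implicit Types z w : R[i].

Lemma ReM_real (x : R) z : complex.Re (x%:C%C * z) = x * complex.Re z.
Proof. by case: z => u v /=; rewrite mul0r subr0. Qed.

Lemma Re_sum (I : Type) (s : seq I) (P : pred I) (f : I -> R[i]) :
  complex.Re (\sum_(i <- s | P i) f i) = \sum_(i <- s | P i) complex.Re (f i).
Proof. by apply: (big_morph (@complex.Re R)) => // -[a b] [c d]. Qed.

(** The increment of the power lies between its two tangent bounds, (m + 1) x^m (y - x) and (m + 1)
    y^m (y - x). This is the derivative of a term of the logarithmic series in the form that
    [nonincreasing_of_quadratic_increments] accepts. *)
Lemma exprS_increment (x y : R) (m : nat) : 0 <= x -> x <= y -> y <= 1 ->
  `|(y ^+ m.+1 - x ^+ m.+1) / m.+1%:R - x ^+ m * (y - x)| <= m%:R * (y - x) ^+ 2.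
Proof.
move=> x0 xy y1; have y0 : 0 <= y by exact: le_trans xy.
have x1 : x <= 1 by exact: le_trans y1.
have mono k : x ^+ k <= y ^+ k by rewrite lerXn2r ?nnegrE.
have diff k : y ^+ k - x ^+ k <= k%:R * (y - x).
  elim: k => [|k IH]; first by rewrite !expr0 subrr mul0r.
  rewrite !exprS -natr1.
  have yk0 : 0 <= y ^+ k by exact: exprn_ge0.
  have xk1 : x ^+ k <= 1 by exact: exprn_ile1.
  have := mono k.
  move: (y ^+ k) (x ^+ k) (k%:R) IH yk0 xk1 => Y X K IH Y0 X1 XY; nra.
have m0 : (0 : R) < m.+1%:R by rewrite ltr0n.
have low : m.+1%:R * x ^+ m * (y - x) <= y ^+ m.+1 - x ^+ m.+1.
  elim: m {m0} => [|m IH]; first by rewrite expr0 !mul1r !expr1.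
  rewrite !(exprS _ m.+1) -natr1.
  have : m.+1%:R * x ^+ m * (y - x) * x <= (y ^+ m.+1 - x ^+ m.+1) * x by rewrite ler_wpM2r.
  have := mono m.+1; rewrite [x ^+ m.+1]exprS.
  move: (m.+1%:R) (x ^+ m) (y ^+ m.+1) {IH} => K X Y H1 H2; nra.
have high : y ^+ m.+1 - x ^+ m.+1 <= m.+1%:R * y ^+ m * (y - x).
  elim: m {m0 low} => [|m IH]; first by rewrite expr0 !mul1r !expr1.
  rewrite !(exprS _ m.+1) -natr1.
  have : (y ^+ m.+1 - x ^+ m.+1) * y <= m.+1%:R * y ^+ m * (y - x) * y by rewrite ler_wpM2r.
  have := mono m.+1; rewrite [y ^+ m.+1]exprS.
  move: (m.+1%:R) (y ^+ m) (x ^+ m.+1) {IH} => K Y X H1 H2; nra.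
rewrite ger0_norm; last by rewrite subr_ge0 ler_pdivlMr // mulrC mulrA.
rewrite lerBlDr ler_pdivrMr //; apply: le_trans high _.
rewrite [leRHS]mulrC -mulrA ler_wpM2l ?ler0n // expr2 mulrA -mulrDl.
rewrite ler_wpM2r ?subr_ge0 //; have := diff m; lra.
Qed.

(** The remainder is z (x z)^M / (1 - x z), and |1 - x z| >= 1 - x. It serves both for the
    derivative of the logarithmic series and for the truncated Poisson kernel. *)
Lemma geometric_remainder z (x : R) (M : nat) : 0 <= x -> x < 1 -> cmod z <= 1 ->
  `|\sum_(m < M) x ^+ m * complex.Re (z ^+ m.+1) - complex.Re (z / (1 - x%:C%C * z))| <=
  x ^+ M / (1 - x).
Proof.
move=> x0 x1 z1; set w := 1 - _ * z.
have xz : cmod (x%:C%C * z) <= x by rewrite cmodM cmod_real ger0_norm // ler_piMr.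
have w0 : 1 - x <= cmod w.
  have := cmodD w (x%:C%C * z); rewrite subrK cmod1; lra.
have wn0 : w != 0 by rewrite -cmod_gt0; lra.
have -> : \sum_(m < M) x ^+ m * complex.Re (z ^+ m.+1) =
    complex.Re (z / w - z * (x%:C%C * z) ^+ M / w).
  have -> : z / w - z * (x%:C%C * z) ^+ M / w = \sum_(m < M) (x ^+ m)%:C%C * z ^+ m.+1.
    set y := x%:C%C * z in w xz w0 wn0 *.
    have E : 1 - y ^+ M = w * \sum_(m < M) y ^+ m by rewrite -opprB subrX1 -mulNr opprB.
    have -> : \sum_(m < M) (x ^+ m)%:C%C * z ^+ m.+1 = z * \sum_(m < M) y ^+ m.
      rewrite mulr_sumr; apply: eq_bigr => m _.
      by rewrite /y exprMn mulrCA -exprS rmorphXn.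
    apply: (mulIf wn0); rewrite mulrBl !divfK // -[X in X - _]mulr1 -mulrBr E.
    by rewrite mulrA [LHS]mulrAC.
  by rewrite Re_sum; apply: eq_bigr => m _; rewrite ReM_real.
have ReB u v : complex.Re (u - v) = complex.Re u - complex.Re v :> R by case: u; case: v.
rewrite ReB addrAC subrr add0r normrN; apply: le_trans (norm_Re_le_cmod _) _.
rewrite !cmodM cmodV cmodX.
apply: ler_pM; rewrite ?mulr_ge0 ?exprn_ge0 ?invr_ge0 ?cmod_ge0 //.
  rewrite -[leRHS]mul1r ler_pM ?exprn_ge0 ?cmod_ge0 //.
  by rewrite lerXn2r ?nnegrE ?cmod_ge0.
by rewrite lef_pV2 ?posrE //; lra.
Qed.

Lemma Re_divB (x : R) z : 1 - x%:C%C * z != 0 ->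
  complex.Re (z / (1 - x%:C%C * z)) =
  (complex.Re z - x * cmod z ^+ 2) / cmod (1 - x%:C%C * z) ^+ 2.
Proof.
rewrite -cmod_eq0 -sqrf_eq0 !cmod_sqr; case: z => a b /=.
by rewrite !mul0r !addr0 subr0 !sub0r sqrrN => D; field.
Qed.

(** In x, the partial sum has derivative sum x^m Re z^(m+1) and ln |1 - x z| has derivative - Re(z /
    (1 - x z)). By [geometric_remainder] their sum is at most [tau] on [0, q], so that subtracting
    [tau * x] gives a nonincreasing function vanishing at 0. *)
Lemma log_series_partial_le z (q : R) (M : nat) : 0 < q -> q < 1 -> cmod z <= 1 ->
  \sum_(m < M) q ^+ m.+1 / m.+1%:R * complex.Re (z ^+ m.+1) <=
  - ln (cmod (1 - q%:C%C * z)) + q ^+ M / (1 - q).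
Proof.
move=> q0 q1 z1; pose u := complex.Re z; pose v := complex.Im z.
have uv : u ^+ 2 + v ^+ 2 <= 1.
  by rewrite -cmod_sqr; rewrite exprn_ile1 // cmod_ge0.
pose D (x : R) := (1 - x * u) ^+ 2 + (x * v) ^+ 2.
have DE x : D x = cmod (1 - x%:C%C * z) ^+ 2.
  rewrite cmod_sqr /D /u /v; case: (z) => a b /=; rewrite !mul0r addr0 subr0 sub0r sqrrN //.
have Dge x : 0 <= x -> x <= q -> (1 - q) ^+ 2 <= D x.
  move=> x0 xq; rewrite DE lerXn2r ?nnegrE ?cmod_ge0 ?subr_ge0 ?(ltW q1) //.
  have := cmodD (1 - x%:C%C * z) (x%:C%C * z); rewrite subrK cmod1 cmodM cmod_real ger0_norm //.
  have := cmod_ge0 z; nra.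
pose tau := q ^+ M / (1 - q).
pose c m := complex.Re (z ^+ m.+1).
have c1 m : `|c m| <= 1.
  by apply: le_trans (norm_Re_le_cmod _) _; rewrite cmodX exprn_ile1 // cmod_ge0.
pose G x := \sum_(m < M) x ^+ m.+1 / m.+1%:R * c m + ln (D x) / 2 - tau * x.
have G0 : G 0 = 0.
  rewrite /G big1 => [|m _]; last by rewrite expr0n /= !mul0r.
  by rewrite /D !mul0r subr0 expr1n expr0n /= addr0 ln1; ring.
have : G q <= G 0.
  apply: (@nonincreasing_of_quadratic_increments R G 0 q
    (\sum_(m < M) m%:R + ((1 - q) ^+ 2)^-1)); first exact: ltW.
  move=> x y x0 xy yq.
  have y0 : 0 <= y by exact: le_trans xy.
  have xq : x <= q by exact: le_trans yq.
  have q2 : 0 < (1 - q) ^+ 2 by rewrite exprn_gt0 // subr_gt0.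
  have Dx : 0 < D x by apply: lt_le_trans (Dge _ x0 xq).
  have Dy : 0 < D y by apply: lt_le_trans (Dge _ y0 yq).
  have sumP : \sum_(m < M) y ^+ m.+1 / m.+1%:R * c m - \sum_(m < M) x ^+ m.+1 / m.+1%:R * c m
     <= (y - x) * (\sum_(m < M) x ^+ m * c m) + (\sum_(m < M) m%:R) * (y - x) ^+ 2.
    rewrite -sumrB mulr_sumr mulr_suml -big_split /=; apply: ler_sum => m _.
    have := exprS_increment m x0 xy (le_trans yq (ltW q1)).
    set e := _ - _ => He.
    have -> : y ^+ m.+1 / m.+1%:R * c m - x ^+ m.+1 / m.+1%:R * c m =
       (y - x) * (x ^+ m * c m) + e * c m by rewrite /e; ring.
    rewrite lerD2l; apply: le_trans (ler_norm _) _; rewrite normrM.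
    by rewrite -[leRHS]mulr1 ler_pM.
  have lnP : ln (D y) - ln (D x) <= (D y - D x) / D x.
    rewrite -ln_div ?posrE //.
    have -> : D y / D x = 1 + (D y - D x) / D x by field; rewrite lt0r_neq0.
    apply: le_ln1Dx; have : 0 < D y / D x by rewrite divr_gt0.
    have -> : D y / D x = 1 + (D y - D x) / D x by field; rewrite lt0r_neq0.
    lra.
  have ReE : complex.Re (z / (1 - x%:C%C * z)) = (u - x * (u ^+ 2 + v ^+ 2)) / D x.
    by rewrite Re_divB -?DE -?cmod_sqr // -cmod_eq0 -sqrf_eq0 -DE lt0r_neq0.
  have geo := le_trans (ler_norm _) (geometric_remainder M x0 (le_lt_trans xq q1) z1).
  rewrite ReE lerBlDl in geo.
  have tauP : x ^+ M / (1 - x) <= tau.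
    apply: ler_pM; rewrite ?exprn_ge0 ?invr_ge0 ?subr_ge0 ?(le_trans xq (ltW q1)) //.
      by rewrite lerXn2r ?nnegrE // ltW.
    by rewrite lef_pV2 ?posrE ?subr_gt0 ?(le_lt_trans xq) //; lra.
  (* Exact second order expansion of |1 - x z|^2, which is quadratic in x. *)
  have DD : (D y - D x) / D x = 2 * ((y - x) * (- ((u - x * (u ^+ 2 + v ^+ 2)) / D x)))
     + (u ^+ 2 + v ^+ 2) * (y - x) ^+ 2 / D x.
    by rewrite {1 2}/D; field; rewrite lt0r_neq0.
  have DD2 : (u ^+ 2 + v ^+ 2) * (y - x) ^+ 2 / D x <= (y - x) ^+ 2 * ((1 - q) ^+ 2)^-1.
    apply: ler_pM.
    - by rewrite mulr_ge0 ?addr_ge0 ?sqr_ge0.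
    - by rewrite invr_ge0 ltW.
    - by rewrite ler_piMl ?sqr_ge0.
    - by rewrite lef_pV2 ?posrE // Dge.
  have h0 : 0 <= y - x by rewrite subr_ge0.
  have := ler_wpM2l h0 (le_trans geo (lerD (lexx _) tauP)).
  rewrite DD in lnP.
  have i0 : 0 <= (y - x) ^+ 2 * ((1 - q) ^+ 2)^-1.
    by rewrite mulr_ge0 ?sqr_ge0 // invr_ge0 ltW.
  rewrite /G mulrDl.
  move: sumP lnP DD2 i0.
  move: (\sum_(m < M) y ^+ m.+1 / _ * _) (\sum_(m < M) x ^+ m.+1 / _ * _).
  move: (\sum_(m < M) x ^+ m * c m) (\sum_(m < M) m%:R) (ln (D y)) (ln (D x)).
  move: ((u - x * (u ^+ 2 + v ^+ 2)) / D x) (_ * (y - x) ^+ 2 / D x) ((1 - q) ^+ 2)^-1.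
  by move=> *; lra.
rewrite G0 /G -/tau.
have C0 : 0 < cmod (1 - q%:C%C * z).
  have := Dge q (ltW q0) (lexx _); rewrite DE => h.
  rewrite lt_def cmod_ge0 andbT; apply/eqP => E; move: h; rewrite E expr0n /=.
  by rewrite leNgt exprn_gt0 // subr_gt0.
have -> : ln (D q) = 2 * ln (cmod (1 - q%:C%C * z)) by rewrite DE lnXn // mulr_natl.
have tau0 : 0 <= tau by rewrite divr_ge0 ?exprn_ge0 ?subr_ge0 // ltW.
have : tau * q <= tau by rewrite ler_piMr // ltW.
lra.
Qed.

(** With t = rho^2, |1 - t z|^2 - t |1 - z|^2 = (1 - t) (1 - t |z|^2). *)
Lemma cmod_1B_shrink z (rho : R) : 0 < rho -> rho < 1 -> cmod z <= 1 ->
  rho * cmod (1 - z) <= cmod (1 - (rho ^+ 2)%:C%C * z).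
Proof.
move=> r0 r1 z1; rewrite -(@ler_pXn2r _ 2) ?nnegrE ?mulr_ge0 ?cmod_ge0 ?(ltW r0) //.
have : cmod z ^+ 2 <= 1 by rewrite exprn_ile1 // cmod_ge0.
rewrite exprMn !cmod_sqr; case: z z1 => a b _ /=.
rewrite !mul0r addr0 subr0 sub0r; set t := rho ^+ 2 => ab.
have t1 : t <= 1 by rewrite exprn_ile1 // ltW.
have t0 : 0 <= t by exact: sqr_ge0.
have : 0 <= (1 - t) * (1 - t * (a ^+ 2 + b ^+ 2)).
  by rewrite mulr_ge0 ?subr_ge0 // mulr_ile1 // addr_ge0 ?sqr_ge0.
nra.
Qed.

(** With zeta = z conj(w) / max(|z|, |w|)^2 the m-th summand is q^m Re(zeta^m) / m. For q = 1 the
    full series would give - ln |z - w|, since max(|z|, |w|) |1 - zeta| = |z - w|. *)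
Definition smoothed_kernel (q : R) (M : nat) (z w : R[i]) : R :=
  let mx := Num.max (cmod z) (cmod w) in
  - ln mx + \sum_(m < M) q ^+ m.+1 / m.+1%:R *
    (complex.Re ((z * w^*%C) ^+ m.+1) * (mx ^- m.+1) ^+ 2).

Lemma smoothed_kernel_le (q : R) (M : nat) z w (zeta := z * w^*%C / (Num.max (cmod z) (cmod w) ^+ 2)%:C%C) :
  0 < q -> q < 1 -> z != 0 -> w != 0 ->
  [/\ smoothed_kernel q M z w <= - ln (Num.max (cmod z) (cmod w))
         - ln (cmod (1 - q%:C%C * zeta)) + q ^+ M / (1 - q),
      cmod zeta <= 1 &
      Num.max (cmod z) (cmod w) * cmod (1 - zeta) = cmod (z - w)].
Proof.
move=> q0 q1 z0 w0; rewrite /smoothed_kernel; set mx := Num.max _ _.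
have cz : 0 < cmod z by rewrite cmod_gt0.
have cw : 0 < cmod w by rewrite cmod_gt0.
have mx0 : 0 < mx by rewrite lt_max cz.
have zeta1 : cmod zeta <= 1.
  rewrite /zeta cmodM cmodV cmod_real ger0_norm ?sqr_ge0 // cmodM cmod_conj.
  rewrite ler_pdivrMr ?exprn_gt0 // mul1r expr2.
  by apply: ler_pM; rewrite ?cmod_ge0 // le_max lexx ?orbT.
split=> //.
  rewrite -addrA lerD2l; apply: le_trans (log_series_partial_le M q0 q1 zeta1).
  apply: ler_sum => m _.
  suff -> : complex.Re (zeta ^+ m.+1) = complex.Re ((z * w^*%C) ^+ m.+1) * (mx ^- m.+1) ^+ 2 by [].
  rewrite /zeta expr_div_n -rmorphXn /= -fmorphV /= mulrC ReM_real mulrC.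
  by rewrite exprVn -!exprM mulnC.
have mx2 : ((mx ^+ 2)%:C)%C != 0 :> R[i].
  by rewrite fmorph_eq0 expf_neq0 // lt0r_neq0.
apply: (mulfI (lt0r_neq0 mx0)).
have -> : mx * (mx * cmod (1 - zeta)) = cmod ((mx ^+ 2)%:C%C - z * w^*%C).
  have -> : (mx ^+ 2)%:C%C - z * w^*%C = (mx ^+ 2)%:C%C * (1 - zeta).
    by rewrite mulrBr mulr1 /zeta [in RHS]mulrC divfK.
  by rewrite cmodM cmod_real ger0_norm ?sqr_ge0 // mulrA expr2.
have sq t : (cmod t ^+ 2)%:C%C = t * t^*%C.
  by rewrite -sqr_normc cmodE rmorphXn.
rewrite /mx; case: leP => _.
  by rewrite sq -mulrBl cmodM cmod_conj mulrC cmodB.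
by rewrite sq -mulrBr -rmorphB cmodM cmod_conj.
Qed.

Lemma smoothed_kernel_diag (q : R) (M : nat) z : 0 < q -> q < 1 -> z != 0 ->
  smoothed_kernel q M z z <= - ln (cmod z) - ln (1 - q) + q ^+ M / (1 - q).
Proof.
move=> q0 q1 z0; have [H _ E] := smoothed_kernel_le M q0 q1 z0 z0.
apply: le_trans H _; move/eqP: E; rewrite maxxx subrr cmod0 mulf_eq0 !cmod_eq0 (negbTE z0) /=.
rewrite subr_eq0 => /eqP <-; rewrite mulr1.
have -> : (1 - q%:C%C : R[i]) = (1 - q)%:C%C by rewrite rmorphB rmorph1.
by rewrite cmod_real ger0_norm // subr_ge0 ltW.
Qed.

Lemma smoothed_kernel_offdiag (rho : R) (M : nat) z w (q := rho ^+ 2) :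
  0 < rho -> rho < 1 -> z != 0 -> w != 0 -> z != w ->
  smoothed_kernel q M z w <= - ln (cmod (z - w)) - ln rho + q ^+ M / (1 - q).
Proof.
move=> r0 r1 z0 w0 zw.
have q0 : 0 < q by exact: exprn_gt0.
have q1 : q < 1 by rewrite exprn_ilt1 // ltW.
have [H zeta1 E] := smoothed_kernel_le M q0 q1 z0 w0.
apply: le_trans H _; rewrite lerD2r.
have mx0 : 0 < Num.max (cmod z) (cmod w) by rewrite lt_max cmod_gt0 z0.
have zw0 : 0 < cmod (z - w) by rewrite cmod_gt0 subr_eq0.
have n1 : 0 < cmod (1 - z * w^*%C / (Num.max (cmod z) (cmod w) ^+ 2)%:C%C).
  by rewrite -(pmulr_rgt0 _ mx0) E.
have := cmod_1B_shrink r0 r1 zeta1; rewrite -/q => S.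
rewrite -opprD -[leRHS]opprD lerN2 -!lnM ?posrE //; last first.
  by apply: lt_le_trans S; rewrite mulr_gt0.
rewrite ler_ln ?posrE ?mulr_gt0 //; last by apply: lt_le_trans S; rewrite mulr_gt0.
by rewrite -E -[leLHS]mulrA ler_pM2l // mulrC.
Qed.

End LogKernel.

(** * Fourier coefficients on circles *)

Section UnitCircle.
Variable R : realType.

Lemma expiD (s t : R) : expi (s + t) = expi s * expi t.
Proof. by rewrite /expi cosD sinD [X in Complex _ X]addrC. Qed.

Lemma expi0 : expi (0 : R) = 1.
Proof. by rewrite /expi cos0 sin0. Qed.

Lemma expiX (t : R) n : expi t ^+ n = expi (n%:R * t).
Proof.
elim: n => [|n IH]; first by rewrite expr0 mul0r expi0.
by rewrite exprS IH -expiD -natr1 mulrDl mul1r addrC.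
Qed.

Lemma cmod_expi (t : R) : cmod (expi t) = 1.
Proof.
apply/eqP; rewrite -(@eqrXn2 _ 2) ?cmod_ge0 // cmod_sqr expr1n.
by rewrite /= cos2Dsin2.
Qed.

Lemma conj_unit (u : R[i]) : cmod u = 1 -> u^*%C = u^-1.
Proof.
move=> u1; have u0 : u != 0 by rewrite -cmod_gt0 u1.
by apply: (mulfI u0); rewrite -sqr_normc cmodE u1 rmorph1 expr1n divff.
Qed.

Lemma cmod_1B_unit (u : R[i]) : cmod u = 1 -> cmod (1 - u) ^+ 2 = 2 - 2 * complex.Re u.
Proof.
move=> u1; have : cmod u ^+ 2 = 1 by rewrite u1 expr1n.
rewrite !cmod_sqr; case: u {u1} => a b /=; rewrite sub0r sqrrN; lra.
Qed.

Lemma Re_expr_mul (v : R[i]) k : cmod v = 1 ->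
  2 * (complex.Re (v ^+ k.+1) * complex.Re v) = complex.Re (v ^+ k.+2) + complex.Re (v ^+ k).
Proof.
move=> v1; have : cmod v ^+ 2 = 1 by rewrite v1 expr1n.
rewrite cmod_sqr (exprS v k.+1) (exprS v k).
case: (v ^+ k) => a b; case: v {v1} => c d /= /(congr1 ( *%R a)); lra.
Qed.

End UnitCircle.

(** * Discrete Fourier analysis on the roots of unity *)

Section Grid.
Variables (R : realType) (N : nat).
Hypothesis N_gt0 : (0 < N)%N.
Let om : R[i] := expi (2 * pi / N%:R).

Let N_neq0 : N%:R != 0 :> R. Proof. by rewrite pnatr_eq0 -lt0n. Qed.
Let cmod_om : cmod om = 1. Proof. exact: cmod_expi. Qed.
Let om_neq0 : om != 0. Proof. by rewrite -cmod_gt0 cmod_om. Qed.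

Lemma root_of_unity_expN : om ^+ N = 1.
Proof.
rewrite expiX mulrC divfK // /expi mulrC mulr_natr cos2pi sin2pi //.
Qed.

Lemma root_of_unity_neq1 m : (0 < m < N)%N -> om ^+ m != 1.
Proof.
move=> /andP[m0 mN]; rewrite expiX; apply/eqP => /(congr1 (@complex.Re R)) /=.
have -> : m%:R * (2 * pi / N%:R) = (m%:R / N%:R * pi) *+ 2 :> R.
  by rewrite -mulr_natr; ring.
rewrite cos_mulr2n cos2sin2 => E.
have : 0 < sin (m%:R / N%:R * pi : R).
  apply: sin_gt0_pi; rewrite mulr_gt0 ?divr_gt0 ?ltr0n ?pi_gt0 //=.
  by rewrite gtr_pMl ?pi_gt0 // ltr_pdivrMr ?ltr0n // mul1r ltr_nat.
have : sin (m%:R / N%:R * pi : R) ^+ 2 = 0 by move: E; rewrite -mulr_natr; lra.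
by move/eqP; rewrite sqrf_eq0 => /eqP ->; rewrite ltxx.
Qed.

Let sum_roots (y : R[i]) : y ^+ N = 1 -> y != 1 -> \sum_(j < N) y ^+ j = 0.
Proof.
move=> yN y1; have := subrX1 y N; rewrite yN subrr => /esym/eqP.
by rewrite mulf_eq0 subr_eq0 (negbTE y1) /= => /eqP.
Qed.

Let sum_roots_pow m : (0 < m < N)%N -> \sum_(j < N) om^-1 ^+ (j * m) = 0.
Proof.
move=> mN; under eq_bigr do rewrite mulnC exprM.
apply: sum_roots.
  by rewrite exprAC exprVn root_of_unity_expN invr1 expr1n.
by rewrite exprVn invr_eq1 root_of_unity_neq1.
Qed.

Definition dft (f : nat -> R) (m : nat) : R[i] :=
  (N%:R^-1)%:C%C * \sum_(j < N) (f j)%:C%C * om^-1 ^+ (j * m).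

Let conj_term (x : R) k : (x%:C%C * om^-1 ^+ k)^*%C = x%:C%C * om ^+ k.
Proof.
rewrite rmorphM rmorphXn; congr (_ * _ ^+ _); first exact: conjc_real.
by rewrite [LHS]conj_unit ?invrK // cmodV cmod_om invr1.
Qed.

Lemma dft_parseval (f : nat -> R) :
  \sum_(m < N) cmod (dft f m) ^+ 2 = N%:R^-1 * \sum_(j < N) f j ^+ 2.
Proof.
apply: (@complexI R); rewrite rmorph_sum /=.
have sq t : (cmod t ^+ 2)%:C%C = t * t^*%C by rewrite -sqr_normc cmodE rmorphXn.
under eq_bigr => m _.
  rewrite sq /dft rmorphM rmorph_sum /= mulrACA big_distrlr /=.
  over.
rewrite -mulr_sumr exchange_big /=.
rewrite (eq_bigr (fun j : 'I_N => (f j ^+ 2)%:C%C * N%:R)); last first.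
  move=> j _; rewrite exchange_big /= (bigD1 j) //= [X in _ + X]big1 ?addr0.
    rewrite (eq_bigr (fun=> (f j ^+ 2)%:C%C)); first by rewrite sumr_const card_ord mulr_natr.
    by move=> m _; rewrite conj_term mulrACA -exprMn mulVf // expr1n mulr1 -rmorphM expr2.
  move=> l lj; rewrite (eq_bigr (fun m : 'I_N => (f j * f l)%:C%C * (om ^+ l * om^-1 ^+ j) ^+ m)).
    rewrite -mulr_sumr sum_roots ?mulr0 //.
      by rewrite exprMn !(exprAC _ _ N) exprVn root_of_unity_expN invr1 !expr1n mulr1.
    rewrite exprVn -(inj_eq (mulIf (expf_neq0 j om_neq0))) divfK ?expf_neq0 // mul1r.
    case: (ltngtP l j) => [h|h|h]; last by rewrite (val_inj h) eqxx in lj.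
    - rewrite -(subnK (ltnW h)) exprD -{1}[om ^+ l]mul1r (inj_eq (mulIf (expf_neq0 l om_neq0))).
      rewrite eq_sym root_of_unity_neq1 // subn_gt0 h /=.
      by apply: leq_ltn_trans (ltn_ord j); rewrite leq_subr.
    - rewrite -(subnK (ltnW h)) exprD -{2}[om ^+ j]mul1r (inj_eq (mulIf (expf_neq0 j om_neq0))).
      rewrite root_of_unity_neq1 // subn_gt0 h /=.
      by apply: leq_ltn_trans (ltn_ord l); rewrite leq_subr.
  by move=> m _; rewrite conj_term mulrACA rmorphM !exprM exprMn [_ ^+ m * _ ^+ m]mulrC.
rewrite [X in _ * X * _](_ : _ = (N%:R^-1)%:C%C); last exact: conjc_real.
rewrite -mulr_suml -rmorph_sum.
have -> : (N%:R : R[i]) = (N%:R)%:C%C by rewrite rmorph_nat.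
rewrite -!rmorphM; congr (_%:C)%C.
by field.
Qed.

Let cmod_dft_sym (f : nat -> R) m : (m <= N)%N -> cmod (dft f (N - m)) = cmod (dft f m).
Proof.
move=> mN; rewrite /dft !cmodM; congr (_ * _); rewrite -[RHS]cmod_conj rmorph_sum.
congr cmod; apply: eq_bigr => j _; rewrite [RHS]conj_term; congr (_ * _).
have omV : om^-1 != 0 by rewrite invr_eq0.
apply: (mulIf (expf_neq0 (j * m) omV)).
rewrite -exprD -mulnDr subnK // mulnC exprM exprVn root_of_unity_expN invr1 expr1n.
by rewrite -exprMn divff // expr1n.
Qed.

(** Since [f] is real, the coefficients at m and N - m have equal modulus. For 2 M < N the
    frequencies 1, ..., M and their mirror images are disjoint, so that Parseval's sum contains each
    square twice. *)
Lemma dft_bessel (f : nat -> R) M : (M.*2 < N)%N ->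
  cmod (dft f 0) ^+ 2 + 2 * \sum_(k < M) cmod (dft f k.+1) ^+ 2 <=
  N%:R^-1 * \sum_(j < N) f j ^+ 2.
Proof.
move=> MN; rewrite -dft_parseval; pose h m := cmod (dft f m) ^+ 2.
have h0 m : 0 <= h m by exact: sqr_ge0.
rewrite -[\sum_(m < N) _](big_mkord xpredT h).
rewrite (@big_cat_nat _ _ _ 1) //= big_nat1 -/(h 0%N) lerD2l.
rewrite (@big_cat_nat _ _ _ M.+1) //=; last by lia.
have -> : \sum_(1 <= i < M.+1) h i = \sum_(k < M) cmod (dft f k.+1) ^+ 2.
  by rewrite big_add1 big_mkord.
rewrite mulr_natl mulr2n lerD2l (@big_cat_nat _ _ _ (N - M)) //=; [|lia|lia].
have -> : \sum_(N - M <= i < N) h i = \sum_(k < M) cmod (dft f k.+1) ^+ 2.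
  rewrite -{1}[(N - M)%N]add0n big_addn subKn; last by lia.
  rewrite big_nat_rev /= add0n big_mkord; apply: eq_bigr => k _.
  rewrite /h; congr (_ ^+ 2); rewrite -cmod_dft_sym; last by have := ltn_ord k; lia.
  by congr (cmod (dft f _)); have := ltn_ord k; lia.
by rewrite lerDr sumr_ge0.
Qed.

Let dftB (f g : nat -> R) m : dft (fun j => f j - g j) m = dft f m - dft g m.
Proof.
rewrite /dft -mulrBr -sumrB; congr (_ * _); apply: eq_bigr => j _.
by rewrite rmorphB mulrBl.
Qed.

Let dft_shift (f : nat -> R) m : f N = f 0%N -> dft (fun j => f j.+1) m = om ^+ m * dft f m.
Proof.
move=> fN; rewrite /dft mulrCA; congr (_ * _).
pose g j : R[i] := (f j)%:C%C * om^-1 ^+ (j * m).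
have gN : g N = g 0%N.
  by rewrite /g fN mul0n expr0 exprM exprVn root_of_unity_expN invr1 expr1n.
have : \sum_(j < N) g j.+1 = \sum_(j < N) g j.
  apply: (addrI (g 0%N)); transitivity (\sum_(j < N.+1) g j).
    by rewrite big_ord_recl.
  by rewrite big_ord_recr /= gN addrC.
rewrite -/(\sum_(j < N) g j) => <-; rewrite mulr_sumr; apply: eq_bigr => j _.
rewrite /g mulrCA mulSn exprD (mulrA (om ^+ m)) -exprMn divff // expr1n mul1r //.
Qed.

(** om^m - 1 is om - 1 times a sum of m powers of om, and on a fine grid each of these is within
    [kappa] of 1. So the difference quotient on the grid acts on the m-th mode almost like the
    factor m. *)
Lemma root_of_unity_dist M m kappa : (m <= M)%N -> M%:R * cmod (om - 1) <= kappa ->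
  m%:R * (1 - kappa) * cmod (om - 1) <= cmod (om ^+ m - 1).
Proof.
move=> mM Mk; rewrite subrX1 cmodM mulrC ler_wpM2l ?cmod_ge0 //.
have near1 j : cmod (om ^+ j - 1) <= j%:R * cmod (om - 1).
  rewrite subrX1 cmodM mulrC ler_wpM2r ?cmod_ge0 //.
  apply: le_trans (cmod_sum _ _ _) _; under eq_bigr do rewrite cmodX cmod_om expr1n.
  by rewrite sumr_const card_ord.
have E : m%:R = \sum_(i < m) om ^+ i - \sum_(i < m) (om ^+ i - 1) :> R[i].
  by rewrite -sumrB (eq_bigr (fun=> 1)) ?sumr_const ?card_ord // => i _; rewrite subKr.
have cm : cmod (m%:R : R[i]) = m%:R.
  by rewrite -[m%:R](rmorph_nat (real_complex R)) cmod_real ger0_norm ?ler0n.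
have := cmodD (\sum_(i < m) om ^+ i) (- \sum_(i < m) (om ^+ i - 1)).
rewrite -E cm cmodN => H.
suff : cmod (\sum_(i < m) (om ^+ i - 1)) <= m%:R * kappa by lra.
apply: le_trans (cmod_sum _ _ _) _.
apply: (@le_trans _ _ (\sum_(i < m) kappa)); last by rewrite sumr_const card_ord mulr_natl.
apply: ler_sum => i _; apply: le_trans (near1 i) _; apply: le_trans Mk.
by rewrite ler_wpM2r ?cmod_ge0 // ler_nat; have := ltn_ord i; lia.
Qed.

Section Lipschitz.
Variables (phi : R[i] -> R) (A : R).
Hypothesis A_ge0 : 0 <= A.
Hypothesis phi_lip : forall z t : R[i], `|phi z - phi t| <= A * cmod (z - t).

Definition circle_coef (m : nat) (x : R) : R[i] :=
  dft (fun j => phi (x%:C%C * om ^+ j)) m.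

Let mean_le (g : nat -> R) c : (forall j, g j <= c) -> N%:R^-1 * \sum_(j < N) g j <= c.
Proof.
move=> gc; rewrite mulrC ler_pdivrMr ?ltr0n //.
apply: (@le_trans _ _ (\sum_(j < N) c)); first exact: ler_sum.
by rewrite sumr_const card_ord mulr_natr.
Qed.

Lemma circle_coef_radial M x y : (M.*2 < N)%N ->
  cmod (circle_coef 0 y - circle_coef 0 x) ^+ 2
  + 2 * \sum_(k < M) cmod (circle_coef k.+1 y - circle_coef k.+1 x) ^+ 2
  <= A ^+ 2 * (y - x) ^+ 2.
Proof.
move=> MN; pose f j := phi (y%:C%C * om ^+ j) - phi (x%:C%C * om ^+ j).
have E m : circle_coef m y - circle_coef m x = dft f m by rewrite -dftB.
rewrite E; under eq_bigr do rewrite E.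
apply: le_trans (dft_bessel f MN) _; apply: (@mean_le (fun j => f j ^+ 2)) => j.
rewrite -exprMn -[leLHS]real_normK ?num_real // -[leRHS]real_normK ?num_real //.
rewrite lerXn2r ?nnegrE ?normr_ge0 // normrM (ger0_norm A_ge0).
apply: le_trans (phi_lip _ _) _.
by rewrite -mulrBl cmodM cmodX cmod_om expr1n mulr1 -rmorphB cmod_real.
Qed.

(** Bessel's inequality for the differences of neighbouring samples, whose m-th coefficient is om^m
    - 1 times that of the samples. Neighbours lie at distance |x| |om - 1|, and the factor |om - 1|
    cancels against [root_of_unity_dist], which leaves only the loss 1 - kappa. *)
Lemma circle_coef_angular M x kappa : (0 < M)%N -> (M.*2 < N)%N ->
  kappa < 1 -> M%:R * cmod (om - 1) <= kappa ->
  2 * \sum_(k < M) (k.+1)%:R ^+ 2 * cmod (circle_coef k.+1 x) ^+ 2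
  <= (A / (1 - kappa)) ^+ 2 * x ^+ 2.
Proof.
move=> M0 MN k1 Mk; pose f j := phi (x%:C%C * om ^+ j).
have fN : f N = f 0%N by rewrite /f root_of_unity_expN expr0.
have := dft_bessel (fun j => f j.+1 - f j) MN.
have E m : cmod (dft (fun j => f j.+1 - f j) m) = cmod (om ^+ m - 1) * cmod (circle_coef m x).
  by rewrite dftB dft_shift // -[X in _ - X]mul1r -mulrBl cmodM.
under eq_bigr do rewrite E.
rewrite E; set d := cmod (om - 1) => H.
have d0 : 0 < d.
  by rewrite cmod_gt0 subr_eq0 -[om]expr1 root_of_unity_neq1 //; lia.
have B : N%:R^-1 * \sum_(j < N) (f j.+1 - f j) ^+ 2 <= (A * (x * d)) ^+ 2.
  apply: (@mean_le (fun j => (f j.+1 - f j) ^+ 2)) => j.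
  rewrite -[leLHS]real_normK ?num_real // -[leRHS]real_normK ?num_real //.
  rewrite lerXn2r ?nnegrE ?normr_ge0 // !normrM (ger0_norm A_ge0).
  apply: le_trans (phi_lip _ _) _.
  rewrite -mulrBr exprSr -{2}[om ^+ j]mulr1 -mulrBr !cmodM cmodX cmod_om expr1n mul1r cmod_real.
  by rewrite (gtr0_norm d0).
have k0 : 0 < 1 - kappa by rewrite subr_gt0.
have S : (1 - kappa) ^+ 2 * d ^+ 2 * (\sum_(k < M) (k.+1)%:R ^+ 2 * cmod (circle_coef k.+1 x) ^+ 2)
    <= \sum_(k < M) (cmod (om ^+ k.+1 - 1) * cmod (circle_coef k.+1 x)) ^+ 2.
  rewrite mulr_sumr; apply: ler_sum => k _.
  rewrite exprMn mulrA ler_wpM2r ?sqr_ge0 //.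
  have -> : (1 - kappa) ^+ 2 * d ^+ 2 * k.+1%:R ^+ 2 = (k.+1%:R * (1 - kappa) * d) ^+ 2 by ring.
  rewrite lerXn2r ?nnegrE ?cmod_ge0 ?mulr_ge0 ?ler0n ?(ltW k0) ?(ltW d0) //.
  exact: root_of_unity_dist Mk.
have -> : (A / (1 - kappa)) ^+ 2 * x ^+ 2 = (A * (x * d)) ^+ 2 / ((1 - kappa) ^+ 2 * d ^+ 2).
  by field; rewrite !lt0r_neq0.
rewrite ler_pdivlMr ?mulr_gt0 ?exprn_gt0 // mulrC mulrCA.
have := sqr_ge0 (cmod (om ^+ 0 - 1) * cmod (circle_coef 0 x)); lra.
Qed.

(** * Truncated Poisson smoothing on a circle *)

Section Smoothing.
Variables (M : nat) (rho : R).
Hypotheses (M_gt0 : (0 < M)%N) (MN : (M.+1 < N)%N) (rho_gt0 : 0 < rho) (rho_lt1 : rho < 1).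

Definition poisson_partial (v : R[i]) : R :=
  1 + 2 * \sum_(k < M) rho ^+ k.+1 * complex.Re (v ^+ k.+1).

Definition smoothing (x : R) (u : R[i]) : R :=
  complex.Re (circle_coef 0 x)
  + 2 * \sum_(k < M) rho ^+ k.+1 * complex.Re (circle_coef k.+1 x * u ^+ k.+1).

Let eta : R := rho ^+ M / (1 - rho).

Let eta_ge0 : 0 <= eta.
Proof. by rewrite divr_ge0 ?exprn_ge0 ?subr_ge0 // ltW. Qed.

(** The full Poisson kernel is (1 - rho^2) / |1 - rho v|^2 >= 0, and cutting it after M modes
    changes it by at most 2 rho eta. *)
Lemma poisson_partial_ge (v : R[i]) : cmod v = 1 -> - (2 * eta) <= poisson_partial v.
Proof.
move=> v1; have v1' : cmod v <= 1 by rewrite v1.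
have := geometric_remainder M (ltW rho_gt0) rho_lt1 v1'.
have cv : cmod (rho%:C%C * v) = rho by rewrite cmodM cmod_real v1 mulr1 gtr0_norm.
have w0 : 1 - rho%:C%C * v != 0.
  rewrite subr_eq0; apply/eqP => E; by move: rho_lt1; rewrite -cv -E cmod1 ltxx.
rewrite (Re_divB w0) v1 expr1n mulr1.
have C0 : 0 < cmod (1 - rho%:C%C * v) ^+ 2 by rewrite exprn_gt0 // cmod_gt0.
have CE : cmod (1 - rho%:C%C * v) ^+ 2 = 1 - 2 * rho * complex.Re v + rho ^+ 2.
  have : cmod v ^+ 2 = 1 by rewrite v1 expr1n.
  rewrite !cmod_sqr; case: (v) => a b /= /(congr1 ( *%R (rho ^+ 2))); lra.
rewrite ler_norml => /andP[H _]; rewrite /poisson_partial.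
have -> : \sum_(k < M) rho ^+ k.+1 * complex.Re (v ^+ k.+1) =
    rho * \sum_(k < M) rho ^+ k * complex.Re (v ^+ k.+1).
  by rewrite mulr_sumr; apply: eq_bigr => k _; rewrite exprS mulrA.
have h1 : 0 <= 1 + 2 * rho * ((complex.Re v - rho) / cmod (1 - rho%:C%C * v) ^+ 2).
  have -> : 1 + 2 * rho * ((complex.Re v - rho) / cmod (1 - rho%:C%C * v) ^+ 2)
     = (1 - rho ^+ 2) / cmod (1 - rho%:C%C * v) ^+ 2.
    by move: C0; rewrite CE => C0; field; rewrite lt0r_neq0.
  by rewrite divr_ge0 ?(ltW C0) // subr_ge0 exprn_ile1 // ltW.
move: H h1; rewrite -/eta.
move: (\sum_(k < M) _) (_ / cmod _ ^+ 2) => S t H h1.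
have H1 := ler_wpM2l (ltW rho_gt0) H.
have H2 : rho * eta <= eta by rewrite ler_piMl ?eta_ge0 // ltW.
lra.
Qed.

Section OnePoint.
Variables (x : R) (u : R[i]).
Hypotheses (x_ge0 : 0 <= x) (u1 : cmod u = 1).
Let v (j : nat) : R[i] := u * om^-1 ^+ j.

Let cmod_v j : cmod (v j) = 1.
Proof. by rewrite cmodM cmodX cmodV cmod_om invr1 expr1n u1 mulr1. Qed.

Let sum_Re m : (0 < m < N)%N -> \sum_(j < N) complex.Re (v j ^+ m) = 0.
Proof.
move=> mN; rewrite -Re_sum (eq_bigr (fun j : 'I_N => u ^+ m * om^-1 ^+ (j * m))).
  by rewrite -mulr_sumr sum_roots_pow // mulr0.
by move=> j _; rewrite exprMn exprM.
Qed.

Let sum_P : \sum_(j < N) poisson_partial (v j) = N%:R.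
Proof.
rewrite big_split sumr_const card_ord -mulr_sumr exchange_big /= big1 ?mulr0 ?addr0 // => k _.
by rewrite -mulr_sumr sum_Re ?mulr0 //; have := ltn_ord k; lia.
Qed.

(** Multiplication by Re v shifts the modes by one in both directions, so only the mode of order 1
    reaches the constant. The highest mode that arises is M + 1 < N, hence there is no aliasing. *)
Let sum_PRe : \sum_(j < N) poisson_partial (v j) * complex.Re (v j) = N%:R * rho.
Proof.
rewrite (eq_bigr (fun j : 'I_N => complex.Re (v j ^+ 1)
   + \sum_(k < M) rho ^+ k.+1 * (complex.Re (v j ^+ k.+2) + complex.Re (v j ^+ k)))); last first.
  move=> j _; rewrite /poisson_partial mulrDl mul1r expr1 -mulrA mulr_suml mulr_sumr.
  congr (_ + _); apply: eq_bigr => k _; rewrite -Re_expr_mul ?cmod_v //; ring.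
rewrite big_split /= sum_Re ?add0r; last by lia.
rewrite exchange_big /= (bigD1 (Ordinal M_gt0)) //= [X in _ + X]big1 ?addr0.
  rewrite -mulr_sumr big_split /= sum_Re ?add0r; last by lia.
  rewrite (eq_bigr (fun=> 1)) ?sumr_const ?card_ord => [|j _]; last by [].
  by rewrite /= expr1 mulrC.
move=> k k0; have kM := ltn_ord k.
have {}k0 : (nat_of_ord k != 0)%N by apply: contra k0 => /eqP E; apply/eqP/val_inj.
rewrite -mulr_sumr big_split /=.
rewrite (@sum_Re k.+2); last by lia.
by rewrite (@sum_Re k) ?addr0 ?mulr0 //; lia.
Qed.

Let smoothingE : smoothing x u =
  N%:R^-1 * \sum_(j < N) poisson_partial (v j) * phi (x%:C%C * om ^+ j).
Proof.
pose f j := phi (x%:C%C * om ^+ j).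
have coefE m : complex.Re (circle_coef m x * u ^+ m) =
    N%:R^-1 * \sum_(j < N) complex.Re (v j ^+ m) * f j.
  rewrite /circle_coef /dft -mulrA ReM_real mulr_suml Re_sum; congr (_ * _).
  apply: eq_bigr => j _; rewrite -mulrA ReM_real mulrC; congr (complex.Re _ * _).
  by rewrite exprMn mulrC exprM.
rewrite /smoothing -[circle_coef 0 x]mulr1 -(expr0 u) coefE.
under [X in 2 * X]eq_bigr do rewrite coefE.
have -> : \sum_(j < N) poisson_partial (v j) * phi (x%:C%C * om ^+ j) =
    \sum_(j < N) (complex.Re (v j ^+ 0) * f j
   + \sum_(k < M) 2 * rho ^+ k.+1 * (complex.Re (v j ^+ k.+1) * f j)).
  apply: eq_bigr => j _; rewrite /poisson_partial mulrDl expr0; congr (_ + _).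
  by rewrite mulr_sumr mulr_suml; apply: eq_bigr => k _; rewrite !mulrA.
rewrite big_split mulrDr /=; congr (_ + _); rewrite exchange_big /= !mulr_sumr.
by apply: eq_bigr => k _; rewrite -mulr_sumr; ring.
Qed.

(** The kernel P has mean 1, so the error is the mean of P times differences of phi, which are at
    most A x |1 - v|. As |1 - v|^2 = 2 (1 - Re v), one has |1 - v| <= lam / 2 + (1 - Re v) / lam,
    and P averages 1 - Re v to 1 - rho. Truncation may make P negative; replacing |P| by P + 4 eta
    produces the last summand. *)
Lemma smoothing_error (lam : R) : 0 < lam ->
  `|phi (x%:C%C * u) - smoothing x u| <=
  A * x * (lam / 2 + (1 - rho) / lam + eta * (2 * lam + 4 / lam)).
Proof.
move=> lam0; rewrite smoothingE.
have -> : phi (x%:C%C * u) = N%:R^-1 * \sum_(j < N) poisson_partial (v j) * phi (x%:C%C * u).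
  by rewrite -mulr_suml sum_P mulrA mulVf // mul1r.
rewrite -mulrBr -sumrB normrM ger0_norm ?invr_ge0 ?ler0n // mulrC ler_pdivrMr ?ltr0n //.
apply: le_trans (ler_norm_sum _ _ _) _.
apply: (@le_trans _ _ (\sum_(j < N) (A * x * (lam / 2 + lam^-1) * poisson_partial (v j)
   - A * x / lam * (poisson_partial (v j) * complex.Re (v j))
   + A * x * (4 * eta) * (lam / 2 + lam^-1)
   - A * x * (4 * eta) / lam * complex.Re (v j ^+ 1)))); last first.
  rewrite !(big_split, sumrN) /= -!mulr_sumr sum_P sum_PRe sum_Re; last by lia.
  rewrite sumr_const card_ord -mulr_natl le_eqVlt; apply/orP; left; apply/eqP.
  by field; rewrite lt0r_neq0.
apply: ler_sum => j _; rewrite -mulrBr normrM expr1.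
have Pj := poisson_partial_ge (cmod_v j).
have dist : cmod (x%:C%C * u - x%:C%C * om ^+ j) = x * cmod (1 - v j).
  rewrite -mulrBr cmodM cmod_real ger0_norm //; congr (_ * _).
  have E : om ^+ j * v j = u by rewrite /v mulrCA -exprMn divff // expr1n mulr1.
  by rewrite -{1}E -[X in _ - X]mulr1 -mulrBr cmodM cmodX cmod_om expr1n mul1r cmodB.
have absP : `|poisson_partial (v j)| <= poisson_partial (v j) + 4 * eta.
  by rewrite ler_norml; apply/andP; split; have := eta_ge0; lra.
have amgm : cmod (1 - v j) <= lam / 2 + (1 - complex.Re (v j)) / lam.
  have := cmod_1B_unit (cmod_v j); move: (cmod _) => d dE.
  have -> : 1 - complex.Re (v j) = d ^+ 2 / 2 by lra.
  rewrite -subr_ge0.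
  have -> : lam / 2 + d ^+ 2 / 2 / lam - d = (lam - d) ^+ 2 / (2 * lam).
    by field; rewrite lt0r_neq0.
  by rewrite divr_ge0 ?sqr_ge0 // mulr_ge0 // ltW.
apply: (@le_trans _ _ ((poisson_partial (v j) + 4 * eta) *
   (A * (x * (lam / 2 + (1 - complex.Re (v j)) / lam))))).
  apply: ler_pM; rewrite ?normr_ge0 //.
  apply: le_trans (phi_lip _ _) _; rewrite dist.
  by rewrite !ler_wpM2l.
rewrite le_eqVlt; apply/orP; left; apply/eqP.
by field; rewrite lt0r_neq0.
Qed.

End OnePoint.
End Smoothing.

End Lipschitz.
End Grid.

(** Splits a complex mode into a cosine and a sine mode, since [radial_energy_bound] has real
    charges and coefficients. *)
Lemma Re_mul_expr_div (R : realType) (F z : R[i]) (x : R) m :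
  complex.Re (z ^+ m) * (complex.Re F * x ^- m) + - complex.Im (z ^+ m) * (complex.Im F * x ^- m)
  = complex.Re (F * (z / x%:C%C) ^+ m).
Proof.
have -> : F * (z / x%:C%C) ^+ m = (x ^- m)%:C%C * (F * z ^+ m).
  by rewrite expr_div_n -rmorphXn -fmorphV [RHS]mulrC -!mulrA.
rewrite ReM_real.
by case: F => a b; case: (z ^+ m) => c d /=; ring.
Qed.

(** * Discrepancy and energy of the zeros *)

Section Core.
Variables (R : realType) (G N M : nat) (phi : R[i] -> R) (A r rho kappa : R)
  (z : 'I_N -> R[i]).
Let om : R[i] := expi (2 * pi / G%:R).
Hypotheses (A_ge0 : 0 <= A) (r_gt0 : 0 < r) (M_gt0 : (0 < M)%N) (MG : (M.*2 < G)%N)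
  (kappa_ge0 : 0 <= kappa) (kappa_lt1 : kappa < 1) (M_kappa : M%:R * cmod (om - 1) <= kappa)
  (z_neq0 : forall k, z k != 0).
Hypothesis phi_lip : forall z t : R[i], `|phi z - phi t| <= A * cmod (z - t).
Hypothesis phi_supp : forall z : R[i], r <= cmod z -> phi z = 0.

Let G_gt0 : (0 < G)%N. Proof. by lia. Qed.

Local Notation coef := (circle_coef G phi).

(* [ord0] is the unit circle, of charge [- N]; [(k, b)] is the cosine or sine
   mode of order [k + 1]. *)
Let rad (k : 'I_N.+1) : R := if unlift ord0 k is Some l then cmod (z l) else 1.
Let charge (k : 'I_N.+1) : R := if unlift ord0 k is Some l then 1 else - N%:R.
Let mcharge (j : 'I_M * bool) (k : 'I_N.+1) : R :=
  if unlift ord0 k is Some l then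
    (if j.2 then - complex.Im (z l ^+ j.1.+1) else complex.Re (z l ^+ j.1.+1))
  else 0.
Let mode (j : 'I_M * bool) (x : R) : R :=
  if j.2 then complex.Im (coef j.1.+1 x) else complex.Re (coef j.1.+1 x).

Lemma circle_coef_supp m x : r <= x -> coef m x = 0.
Proof.
move=> rx; rewrite /circle_coef /dft big1 ?mulr0 // => j _.
rewrite phi_supp ?mul0r // cmodM cmodX cmod_expi expr1n mulr1 cmod_real.
exact: le_trans (ler_norm _).
Qed.

Let sum_modes (f : 'I_M * bool -> R) :
  \sum_j f j = \sum_(k < M) (f (k, false) + f (k, true)).
Proof.
rewrite (eq_bigr (fun j : 'I_M * bool => f (j.1, j.2))); last by case.
rewrite -(pair_bigA _ (fun k b => f (k, b))) /=; apply: eq_bigr => k _.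
by rewrite big_bool addrC.
Qed.

(** [radial_energy_bound] for the zeros together with the unit circle. The circle has only the mode
    0, so its energy against itself vanishes because ln 1 = 0, and its energy against the zeros is
    the sum of the logarithms of max(1, |z_k|). *)
Lemma smoothed_discrepancy_le (lam : R) : 0 < lam ->
  2 * (\sum_k smoothing G phi M rho (cmod (z k)) (z k / (cmod (z k))%:C%C)
       - N%:R * complex.Re (coef 0 1)) <=
  lam * (2 * N%:R * \sum_k ln (Num.max 1 (cmod (z k)))
         + \sum_k \sum_l smoothed_kernel (rho ^+ 2) M (z k) (z l))
  + lam^-1 * ((A / (1 - kappa)) ^+ 2 * r ^+ 2).
Proof.
move=> lam0.
have k0 : 0 < 1 - kappa by rewrite subr_gt0.
(* The angular bound has the larger constant A / (1 - kappa); the radial bound is weakened to the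
   same constant. *)
have A1 : A ^+ 2 <= (A / (1 - kappa)) ^+ 2.
  have A1 : A <= A / (1 - kappa) by rewrite ler_pdivlMr // ler_piMr // gerBl.
  by rewrite lerXn2r ?nnegrE // (le_trans A_ge0).
have rad0 k : 0 < rad k.
  by rewrite /rad; case: unliftP => // l _; rewrite cmod_gt0.
have neutral : \sum_k charge k = 0.
  rewrite big_ord_recl /charge unlift_none.
  under eq_bigr do rewrite liftK.
  by rewrite sumr_const card_ord addNr.
have H1 (x y : R) : 0 < x -> x < y ->
  (complex.Re (coef 0 y) - complex.Re (coef 0 x)) ^+ 2
    + 2 * \sum_j (mode j y - mode j x) ^+ 2 <= (A / (1 - kappa)) ^+ 2 * (y - x) ^+ 2.
  move=> _ _; apply: (@le_trans _ _ (A ^+ 2 * (y - x) ^+ 2)); last by rewrite ler_wpM2r ?sqr_ge0.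
  apply: le_trans (circle_coef_radial G_gt0 A_ge0 phi_lip x y MG).
  rewrite sum_modes; apply: lerD.
    by rewrite cmod_sqr; case: (coef 0 y); case: (coef 0 x) => a b c d /=; rewrite lerDl sqr_ge0.
  rewrite ler_wpM2l // ler_sum // => k _; rewrite cmod_sqr /mode /=.
  by case: (coef k.+1 y); case: (coef k.+1 x) => a b c d /=.
have H2 (x : R) : 0 < x ->
  2 * \sum_(j : 'I_M * bool) (j.1.+1)%:R ^+ 2 * mode j x ^+ 2 <= (A / (1 - kappa)) ^+ 2 * x ^+ 2.
  move=> _; apply: le_trans (circle_coef_angular G_gt0 A_ge0 phi_lip x M_gt0 MG kappa_lt1 M_kappa).
  rewrite sum_modes ler_wpM2l // ler_sum // => k _.
  by rewrite cmod_sqr /mode /= mulrDr.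
have coef0 := circle_coef_supp.
have H3 (x : R) : r <= x -> complex.Re (coef 0 x) = 0 /\ forall j, mode j x = 0.
  by move=> rx; rewrite /mode !coef0 //; split=> // j; rewrite coef0 //; case: ifP.
have := @radial_energy_bound R _ _ rad charge (fun j : 'I_M * bool => j.1.+1)
  (fun j => rho ^+ j.1.+1) mcharge (fun x => complex.Re (coef 0 x)) mode
  (A / (1 - kappa)) r lam r_gt0 lam0 rad0 (fun=> isT) neutral H1 H2 H3.
have -> : 2 * \sum_k charge k * complex.Re (coef 0 (rad k)) + 4 * \sum_(j : 'I_M * bool) rho ^+ j.1.+1 *
     \sum_k mcharge j k * (mode j (rad k) * rad k ^- j.1.+1) =
  2 * (\sum_k smoothing G phi M rho (cmod (z k)) (z k / (cmod (z k))%:C%C)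
       - N%:R * complex.Re (coef 0 1)).
  have -> : \sum_(j : 'I_M * bool) rho ^+ j.1.+1 *
      \sum_k mcharge j k * (mode j (rad k) * rad k ^- j.1.+1) =
     \sum_l \sum_(k < M) rho ^+ k.+1 *
       complex.Re (coef k.+1 (cmod (z l)) * (z l / (cmod (z l))%:C%C) ^+ k.+1).
    rewrite exchange_big sum_modes /=; apply: eq_bigr => k _.
    rewrite -mulrDr -mulr_sumr -big_split big_ord_recl.
    rewrite /mcharge /rad !unlift_none /= !mul0r !add0r; congr (_ * _).
    by apply: eq_bigr => l _; rewrite !liftK /mode; apply: Re_mul_expr_div.
  rewrite big_ord_recl /charge /rad unlift_none.
  under eq_bigr do rewrite liftK mul1r.
  by rewrite /smoothing big_split /= -mulr_sumr; ring.
set E1 := - _ + _; set E2 := 2 * N%:R * _ + _; suff -> : E1 = E2 by [].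
rewrite {}/E1 {}/E2 sum_modes /=.
have -> : \sum_k \sum_l charge k * charge l * ln (Num.max (rad k) (rad l)) =
   - (2 * N%:R * \sum_k ln (Num.max 1 (cmod (z k))))
   + \sum_k \sum_l ln (Num.max (cmod (z k)) (cmod (z l))).
  rewrite big_ord_recl big_ord_recl /charge /rad unlift_none maxxx ln1 mulr0 add0r.
  have -> : \sum_(i < N) \sum_l (if unlift ord0 (lift ord0 i) is Some _ then 1 else - N%:R) *
     (if unlift ord0 l is Some _ then 1 else - N%:R) *
     ln (Num.max (if unlift ord0 (lift ord0 i) is Some l0 then cmod (z l0) else 1)
                 (if unlift ord0 l is Some l0 then cmod (z l0) else 1)) =
     \sum_(i < N) (- N%:R * ln (Num.max 1 (cmod (z i)))
         + \sum_l ln (Num.max (cmod (z i)) (cmod (z l)))) :> R.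
    apply: eq_bigr => i _; rewrite liftK big_ord_recl unlift_none maxC mul1r; congr (_ + _).
    by apply: eq_bigr => l _; rewrite liftK !mul1r.
  under eq_bigr do rewrite liftK mulr1.
  by rewrite big_split /= -!mulr_sumr; ring.
rewrite opprD opprK -addrA; congr (_ + _).
have -> : \sum_k \sum_l smoothed_kernel (rho ^+ 2) M (z k) (z l) =
  - (\sum_k \sum_l ln (Num.max (cmod (z k)) (cmod (z l)))) +
  \sum_k \sum_l \sum_(m < M) (rho ^+ 2) ^+ m.+1 / m.+1%:R *
    (complex.Re ((z k * (z l)^*%C) ^+ m.+1) * (Num.max (cmod (z k)) (cmod (z l)) ^- m.+1) ^+ 2).
  rewrite -sumrN -big_split; apply: eq_bigr => k _.
  by rewrite -sumrN -big_split.
congr (_ + _).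
under [RHS]eq_bigr do rewrite exchange_big /=.
rewrite exchange_big /=; apply: eq_bigr => m _.
rewrite -mulrDr -exprM -exprM mulnC.
under [RHS]eq_bigr do rewrite -mulr_sumr.
rewrite -mulr_sumr; congr (_ * _).
have drop (v : 'I_N.+1 -> R) : v ord0 = 0 ->
    \sum_k \sum_l v k * v l * (Num.max (rad k) (rad l) ^- m.+1) ^+ 2 =
    \sum_(k < N) \sum_(l < N) v (lift ord0 k) * v (lift ord0 l) *
       (Num.max (cmod (z k)) (cmod (z l)) ^- m.+1) ^+ 2.
  move=> v0; rewrite big_ord_recl big1 => [|l _]; last by rewrite v0 !mul0r.
  rewrite add0r; apply: eq_bigr => k _.
  rewrite big_ord_recl v0 mulr0 mul0r add0r; apply: eq_bigr => l _.
  by rewrite /rad !liftK.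
rewrite !drop; do ?by rewrite /mcharge unlift_none.
rewrite -big_split; apply: eq_bigr => k _ /=.
rewrite -big_split; apply: eq_bigr => l _ /=.
rewrite /mcharge !liftK /= -mulrDl; congr (_ * _).
rewrite exprMn -rmorphXn /=; case: (z k ^+ _) => a b; case: (z l ^+ _) => c d /=.
by ring.
Qed.

End Core.

(** * Energy of the zeros *)

Section Energy.
Variable R : realType.

Lemma prod_ln (I : Type) (s : seq I) (P : pred I) (f : I -> R) :
  (forall i, P i -> 0 < f i) ->
  0 < \prod_(i <- s | P i) f i /\
  ln (\prod_(i <- s | P i) f i) = \sum_(i <- s | P i) ln (f i).
Proof.
move=> f0; elim/big_rec2: _ => [|i x y Pi [x0 xy]]; first by rewrite ln1.
by rewrite mulr_gt0 ?f0 // lnM ?posrE ?f0 // xy.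
Qed.

(** The constant coefficient bounds the diagonal by ln |a| and the resultant bounds the off-diagonal
    terms by (2 N - 1) ln |a|. Together this is 2 N ln |a|, exactly what completes 2 N times the sum
    of ln max(1, |z_k|) to 2 N ln M. *)
Lemma energy_le (N : nat) (Q : {poly int}) (a : R[i]) (z : 'I_N -> R[i]) (rho : R) (M : nat)
    (q := rho ^+ 2) (tau := q ^+ M / (1 - q)) :
  (0 < N)%N -> a != 0 -> injective z -> (forall k, z k != 0) ->
  map_poly intr Q = a *: \prod_(k < N) ('X - (z k)%:P) ->
  0 < rho -> rho < 1 ->
  2 * N%:R * \sum_k ln (Num.max 1 (cmod (z k)))
    + \sum_k \sum_l smoothed_kernel q M (z k) (z l) <=
  2 * N%:R * ln (cmod a * \prod_k Num.max 1 (cmod (z k)))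
    + N%:R * (- ln (1 - q)) + N%:R ^+ 2 * (- ln rho + tau).
Proof.
move=> N0 a0 zi z0 QE rho0 rho1.
have q0 : 0 < q by exact: exprn_gt0.
have q1 : q < 1 by rewrite exprn_ilt1 // ltW.
have ca : 0 < cmod a by rewrite cmod_gt0.
have [pm lnm] := @prod_ln _ (index_enum 'I_N) xpredT (fun k => Num.max 1 (cmod (z k)))
  (fun k _ => ltac:(by rewrite lt_max ltr01)).
have [pz lnz] := @prod_ln _ (index_enum 'I_N) xpredT (fun k => cmod (z k))
  (fun k _ => ltac:(by rewrite cmod_gt0)).
have zkl k l : l != k -> 0 < cmod (z k - z l).
  by move=> lk; rewrite cmod_gt0 subr_eq0; apply: contraNneq lk => /zi ->.
have pd k : 0 < \prod_(l | l != k) cmod (z k - z l) by exact: (prod_ln _ (zkl k)).1.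
have [pdd lnd] := @prod_ln _ (index_enum 'I_N) xpredT
  (fun k => \prod_(l | l != k) cmod (z k - z l)) (fun k _ => pd k).
have h1 : 0 <= ln (cmod a) + \sum_k ln (cmod (z k)).
  rewrite -lnz -lnM ?posrE // ln_ge0 //.
  exact: lead_prod_roots_ge1 a0 QE z0.
have h2 : 0 <= (N + N.-1)%:R * ln (cmod a) + \sum_k \sum_(l | l != k) ln (cmod (z k - z l)).
  under [X in _ + X]eq_bigr => k _ do rewrite -(prod_ln _ (zkl k)).2.
  rewrite -lnd mulr_natl -lnXn // -lnM ?posrE ?exprn_gt0 // ln_ge0 //.
  exact: lead_prod_differences_ge1 a0 QE zi.
have lr : 0 <= - ln rho by rewrite oppr_ge0 ln_le0 // ltW.
have tau0 : 0 <= tau.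
  by apply: divr_ge0; [apply/exprn_ge0/ltW | rewrite subr_ge0 ltW].
have NR : (N.-1)%:R + 1 = N%:R :> R by rewrite natr1 prednK.
have K : \sum_k \sum_l smoothed_kernel q M (z k) (z l) <=
   - \sum_k ln (cmod (z k)) - \sum_k \sum_(l | l != k) ln (cmod (z k - z l))
   + N%:R * (- ln (1 - q) + tau + (N.-1)%:R * (- ln rho + tau)).
  have -> : - \sum_k ln (cmod (z k)) - \sum_k \sum_(l | l != k) ln (cmod (z k - z l))
   + N%:R * (- ln (1 - q) + tau + (N.-1)%:R * (- ln rho + tau)) =
   \sum_k (- ln (cmod (z k)) - ln (1 - q) + tau +
           \sum_(l | l != k) (- ln (cmod (z k - z l)) - ln rho + tau)).
    have E k : \sum_(l | l != k) (- ln (cmod (z k - z l)) - ln rho + tau) =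
        - \sum_(l | l != k) ln (cmod (z k - z l)) + (N.-1)%:R * (- ln rho + tau).
      under eq_bigr do rewrite -addrA.
      rewrite big_split sumrN /= sumr_const mulr_natl; congr (_ + _ *+ _).
      by transitivity #|predC1 k|; [apply: eq_card | rewrite cardC1 card_ord].
    under [RHS]eq_bigr do rewrite E.
    have sc (c : R) : \sum_(k < N) c = N%:R * c by rewrite sumr_const card_ord mulr_natl.
    rewrite !big_split !sumrN /= !sc; ring.
  apply: ler_sum => k _; rewrite (bigD1 k) //=; apply: lerD.
    exact: smoothed_kernel_diag.
  apply: ler_sum => l lk; apply: smoothed_kernel_offdiag => //.
  by rewrite -subr_eq0 -cmod_gt0 zkl.
rewrite lnM ?posrE // lnm.
rewrite natrD in h2.
have e1 : N%:R * (N%:R * (- ln rho)) >= N%:R * (N.-1)%:R * (- ln rho).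
  by rewrite mulrA ler_wpM2r // ler_wpM2l // ler_nat leq_pred.
have e2 : (N.-1)%:R = N%:R - 1 :> R by rewrite -NR addrK.
rewrite e2 in h2 K e1.
lra.
Qed.

(** The inverse of e^(-1/6) >= 5/6. Its powers suffice for the logarithms below: (6/5)^6 < 3 and
    (6/5)^21 < 55. *)
Lemma expR_sixth_le : expR (6^-1 : R) <= 6 / 5.
Proof.
have := expR_ge1Dx (- 6^-1 : R); rewrite expRN.
have := expR_gt0 (6^-1 : R); move: (expR _) => e e0 h.
by rewrite -lef_pV2 ?posrE ?divr_gt0 // invf_div; lra.
Qed.

Lemma ln_ge1 (x : R) : 3 <= x -> 1 <= ln x.
Proof.
move=> x3; rewrite -[leLHS]expRK ler_ln ?posrE ?expR_gt0 //; last lra.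
apply: le_trans x3; have -> : (1 : R) = 6%:R * 6^-1 by field.
rewrite expRM_natl; apply: (@le_trans _ _ ((6 / 5) ^+ 6)); last by lra.
by rewrite lerXn2r ?nnegrE ?expR_ge0 ?expR_sixth_le // divr_ge0.
Qed.

Lemma ln_natr_ge (n : nat) : (55 <= n)%N -> 7 / 2 <= ln (n%:R : R).
Proof.
move=> n55; have n0 : (55 : R) <= n%:R by rewrite ler_nat.
rewrite -[leLHS]expRK ler_ln ?posrE ?expR_gt0 //; last lra.
apply: le_trans n0; have -> : (7 / 2 : R) = 21%:R * 6^-1 by field.
rewrite expRM_natl; apply: (@le_trans _ _ ((6 / 5) ^+ 21)); last by lra.
by rewrite lerXn2r ?nnegrE ?expR_ge0 ?expR_sixth_le // divr_ge0.
Qed.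

Lemma ln8_le : ln (8 : R) <= 43 / 20.
Proof.
rewrite -[leRHS]expRK ler_ln ?posrE ?expR_gt0 //.
have -> : (43 / 20 : R) = 43%:R * 20^-1 by field.
rewrite expRM_natl; apply: (@le_trans _ _ ((1 + 20^-1) ^+ 43)); first by lra.
by rewrite lerXn2r ?nnegrE ?expR_ge0 ?expR_ge1Dx // addr_ge0 ?invr_ge0.
Qed.

Lemma exists_geometric_le (rho e : R) : 0 < rho -> rho < 1 -> 0 < e ->
  exists2 M, (0 < M)%N & rho ^+ M / (1 - rho) <= e.
Proof.
move=> r0 r1 e0.
have : rho ^+ n @[n --> \oo] --> (0 : R) by apply: cvg_expr; rewrite gtr0_norm.
move/cvgrPdist_lt => /(_ (e * (1 - rho))).
have h : 0 < e * (1 - rho) by rewrite mulr_gt0 // subr_gt0.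
move=> /(_ h) [K _ HK]; exists K.+1 => //.
rewrite ler_pdivrMr ?subr_gt0 //; apply: ltW.
have := HK K.+1 (leqnSn K); rewrite /= sub0r normrN gtr0_norm //.
exact: exprn_gt0.
Qed.

Lemma exists_fine_grid (M : nat) (e : R) : 0 < e ->
  exists2 G, (M.*2 < G)%N & cmod (expi (2 * pi / G%:R) - 1 : R[i]) <= e.
Proof.
move=> e0; have := @continuous_cos R 0; rewrite /continuous_at cos0.
move/cvgrPdist_lt => /(_ (e ^+ 2 / 2)).
have h : 0 < e ^+ 2 / 2 by rewrite divr_gt0 ?exprn_gt0.
move=> /(_ h) [d d0 Hd]; have {}d0 : 0 < d := d0.
pose G := maxn M.*2.+1 (Num.truncn (2 * pi / d)).+1.
have G0 : (0 < G)%N by rewrite /G leq_max ltn0Sn.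
exists G; first by rewrite /G leq_max ltnSn.
have GR : (0 : R) < G%:R by rewrite ltr0n.
have xd : 2 * pi / G%:R < d.
  rewrite ltr_pdivrMr // [ltRHS]mulrC -ltr_pdivrMr //.
  have tG : ((Num.truncn (2 * pi / d)).+1%:R : R) <= G%:R by rewrite ler_nat leq_max leqnn orbT.
  exact: lt_le_trans (truncnS_gt _) tG.
have H : `|1 - cos (2 * pi / G%:R : R)| < e ^+ 2 / 2.
  apply: Hd; rewrite /= sub0r normrN ger0_norm // divr_ge0 ?(ltW GR) //.
  by rewrite mulr_ge0 ?pi_ge0.
rewrite -(@ler_pXn2r _ 2) ?nnegrE ?cmod_ge0 ?(ltW e0) //.
rewrite cmod_sqr /= subr0.
have := cos2Dsin2 (2 * pi / G%:R : R); have := ler_norm (1 - cos (2 * pi / G%:R : R)).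
move: (cos _) (sin _) H => c s; lra.
Qed.

End Energy.

(** * The mean over the unit circle *)

Section CircleIntegral.
Variables (R : realType) (phi : R[i] -> R) (A : R).
Hypothesis A_ge0 : 0 <= A.
Hypothesis phi_lip : forall z t : R[i], `|phi z - phi t| <= A * cmod (z - t).

Let g (t : R) : R := phi (expi t).

(** A chord grows with its angle up to the angle pi. *)
Lemma cmod_expiB_le (s t h : R) : s <= t -> t <= s + h -> h <= pi ->
  cmod (expi t - expi s) <= cmod (expi h - 1).
Proof.
move=> st th hpi.
have -> : expi t = expi s * expi (t - s) by rewrite -expiD addrC subrK.
rewrite -{2}[expi s]mulr1 -mulrBr cmodM cmod_expi mul1r.
rewrite -(@ler_pXn2r _ 2) ?nnegrE ?cmod_ge0 // !(cmodB _ 1) !cmod_1B_unit ?cmod_expi //=.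
have ts0 : 0 <= t - s by lra.
have tsh : t - s <= h by lra.
suff : cos h <= cos (t - s) by lra.
move: tsh; rewrite le_eqVlt => /predU1P[->|tsh]; first by [].
by rewrite ltW // ltr_cos // in_itv /= ?ts0 ?(le_trans ts0 (ltW tsh)) //; lra.
Qed.

Let g_continuous : continuous g.
Proof.
move=> t; apply/cvgrPdist_lt => e e0.
(* [A + 1] in place of [A], which may be 0 here. *)
have d0 : 0 < e / (2 * (A + 1)) by rewrite divr_gt0 // mulr_gt0 // ltr_wpDl.
have /cvgrPdist_lt /(_ _ d0) Hc := @continuous_cos R t.
have /cvgrPdist_lt /(_ _ d0) Hs := @continuous_sin R t.
near=> s.
have hc : `|cos t - cos s| < e / (2 * (A + 1)) by near: s.
have hs : `|sin t - sin s| < e / (2 * (A + 1)) by near: s.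
apply: le_lt_trans (phi_lip _ _) _.
have : cmod (expi t - expi s) <= `|cos t - cos s| + `|sin t - sin s|.
  rewrite -(@ler_pXn2r _ 2) ?nnegrE ?cmod_ge0 ?addr_ge0 ?normr_ge0 //.
  rewrite cmod_sqr /= -[(cos t - cos s) ^+ 2]real_normK ?num_real //.
  rewrite -[(sin t - sin s) ^+ 2]real_normK ?num_real //.
  have := normr_ge0 (cos t - cos s); have := normr_ge0 (sin t - sin s).
  move: `|_| `|_| => x y x0 y0; nra.
move=> H; apply: (@le_lt_trans _ _ (A * (`|cos t - cos s| + `|sin t - sin s|))).
  by rewrite ler_wpM2l.
have eE : e = (A + 1) * (e / (2 * (A + 1)) + e / (2 * (A + 1))).
  by field; rewrite lt0r_neq0 // ltr_wpDl.
have hcs : `|cos t - cos s| + `|sin t - sin s| < e / (2 * (A + 1)) + e / (2 * (A + 1)).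
  exact: ltrD.
rewrite [ltRHS]eE; apply: le_lt_trans (_ : (A + 1) * (`|cos t - cos s| + `|sin t - sin s|) < _).
  by rewrite ler_wpM2r ?addr_ge0 ?normr_ge0 // lerDl.
by rewrite ltr_pM2l // ltr_wpDl.
Unshelve. all: by end_near.
Qed.

Let continuous_itv_integrable (f : R -> R) (I : interval R) (a b : R) :
  continuous f -> [set` I] `<=` `[a, b] ->
  lebesgue_measure.-integrable [set` I] (EFin \o f).
Proof.
move=> fc Iab; have : lebesgue_measure.-integrable `[a, b] (EFin \o f).
  apply: continuous_compact_integrable; first exact: segment_compact.
  exact: continuous_subspaceT.
by apply: integrableS.
Qed.

(** On each arc between neighbouring grid points phi differs from its value at the left end by at
    most A times the chord. The condition 1 < N keeps the step 2 pi / N within [0, pi], where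
    [cmod_expiB_le] applies. *)
Lemma circle_integral_mean (N : nat) : (1 < N)%N ->
  `|circle_integral phi - N%:R^-1 * \sum_(j < N) phi (expi (2 * pi / N%:R) ^+ j)| <=
  A * cmod (expi (2 * pi / N%:R) - 1 : R[i]).
Proof.
move=> N1; set h : R := 2 * pi / N%:R.
have NR : (0 : R) < N%:R by rewrite ltr0n; lia.
have h0 : 0 < h by rewrite divr_gt0 // mulr_gt0 // pi_gt0.
have hpi : h <= pi.
  rewrite ler_pdivrMr // mulrC ler_wpM2l ?pi_ge0 // ler_nat //.
set d := cmod _.
have step (k : nat) : `|\int[lebesgue_measure]_(t in `[0, k%:R * h]) g t
    - h * \sum_(j < k) phi (expi h ^+ j)| <= k%:R * (h * (A * d)).
  elim: k => [|k IH].
    by rewrite !mul0r set_itv1 Rintegral_set1 big_ord0 mulr0 subrr normr0.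
  have kh : 0 <= k%:R * h by rewrite mulr_ge0 ?ler0n // ltW.
  have kk : k%:R * h <= k.+1%:R * h by rewrite ler_wpM2r ?ler_nat // ltW.
  have := @Rintegral_itvB R g (BLeft 0) (BRight (k.+1%:R * h)) (k%:R * h).
  move=> /(_ (continuous_itv_integrable g_continuous (fun _ x => x))).
  rewrite !bnd_simp => /(_ kh kk) E.
  pose J := \int[lebesgue_measure]_(t in `]k%:R * h, k.+1%:R * h]) g t.
  have -> : \int[lebesgue_measure]_(t in `[0, k.+1%:R * h]) g t =
     \int[lebesgue_measure]_(t in `[0, k%:R * h]) g t + J by rewrite /J -E addrC subrK.
  have HJ : `|J - h * phi (expi h ^+ k)| <= h * (A * d).
    have sub : [set` `]k%:R * h, k.+1%:R * h] ] `<=` `[k%:R * h, k.+1%:R * h].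
      exact: subset_itv_oc_cc.
    have mu : fine (lebesgue_measure [set` `]k%:R * h, k.+1%:R * h] ]) = h.
      rewrite lebesgue_measure_itv /= lte_fin.
      rewrite ltr_pM2r // ltr_nat ltnSn /= -natr1; ring.
    pose c := phi (expi h ^+ k).
    have gc : continuous (fun t => g t - c).
      by move=> t; apply: cvgB; [exact: g_continuous | exact: cvg_cst].
    have -> : h * phi (expi h ^+ k) =
        \int[lebesgue_measure]_(t in `]k%:R * h, k.+1%:R * h]) phi (expi h ^+ k).
      by rewrite Rintegral_cst // mu mulrC.
    rewrite /J -RintegralB //; last 2 first.
    - exact: continuous_itv_integrable g_continuous sub.
    - by apply: continuous_itv_integrable sub => x; exact: cvg_cst.
    apply: le_trans (le_normr_Rintegral _ _) _ => //.
      exact: continuous_itv_integrable gc sub.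
    have -> : h * (A * d) = \int[lebesgue_measure]_(t in `]k%:R * h, k.+1%:R * h]) (A * d).
      by rewrite Rintegral_cst // mu mulrC.
    apply: le_Rintegral => //.
    - apply: continuous_itv_integrable sub => t.
      by apply: (@cvg_norm _ _ _ _ _ (fun t => g t - c)); exact: gc.
    - by apply: continuous_itv_integrable sub => x; exact: cvg_cst.
    move=> t /=; rewrite in_itv /= => /andP[t1 t2].
    apply: le_trans (phi_lip _ _) _; rewrite ler_wpM2l // expiX.
    apply: cmod_expiB_le => //; first exact: ltW.
    by apply: le_trans t2 _; rewrite -natr1 mulrDl mul1r.
  rewrite big_ord_recr /= mulrDr -natr1 mulrDl mul1r.
  apply: le_trans (lerD IH HJ); apply: le_trans (ler_normD _ _).
  by rewrite addrACA opprD.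
have := step N; rewrite /circle_integral.
have -> : N%:R * h = 2 * pi by rewrite /h mulrC divfK // lt0r_neq0.
have pi0 : (0 : R) < 2 * pi by rewrite mulr_gt0 // pi_gt0.
move=> H.
have -> : (2 * pi)^-1 * \int[lebesgue_measure]_(t in `[0, 2 * pi]) phi (expi t)
    - N%:R^-1 * \sum_(j < N) phi (expi h ^+ j) =
  (2 * pi)^-1 * (\int[lebesgue_measure]_(t in `[0, 2 * pi]) g t
    - h * \sum_(j < N) phi (expi h ^+ j)).
  by rewrite mulrBr mulrA; congr (_ - _ * _); rewrite /h mulKf // lt0r_neq0.
rewrite normrM gtr0_norm ?invr_gt0 // mulrC ler_pdivrMr //.
apply: le_trans H _; rewrite mulrA /h mulrC (mulrC N%:R) divfK ?lt0r_neq0 //.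
Qed.

End CircleIntegral.

(** * The discrepancy bound *)

(** t / (c s) is the minimizer of lam c^2 s^2 + t^2 / lam. *)
Lemma amgm_scale (R : realType) (t s c e E : R) : 0 < t -> 0 < s -> 0 < c -> e <= c ^+ 2 ->
  E <= e * s ^+ 2 -> t / (c * s) * E + (t / (c * s))^-1 * t ^+ 2 <= 2 * (c * t * s).
Proof.
move=> t0 s0 c0 ec Ee.
have Ec : E <= c ^+ 2 * s ^+ 2 by apply: le_trans Ee _; rewrite ler_wpM2r ?sqr_ge0.
have l0 : 0 <= t / (c * s) by rewrite divr_ge0 ?mulr_ge0 // ltW.
have H := ler_wpM2l l0 Ec.
have -> : (t / (c * s))^-1 * t ^+ 2 = c * t * s by field; rewrite !lt0r_neq0.
apply: le_trans (lerD H (lexx _)) _.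
rewrite le_eqVlt; apply/orP; left; apply/eqP.
by field; rewrite !lt0r_neq0.
Qed.

Lemma le_of_sqr (R : realType) (c x : R) : 0 <= x -> c ^+ 2 <= x ^+ 2 -> c <= x.
Proof.
move=> x0 cx; rewrite leNgt; apply/negP => h.
by move: cx; rewrite leNgt ltrXn2r.
Qed.

Lemma Re_circle_coef0 (R : realType) (G : nat) (phi : R[i] -> R) :
  complex.Re (circle_coef G phi 0 1) =
  G%:R^-1 * \sum_(j < G) phi (expi (2 * pi / G%:R) ^+ j).
Proof.
rewrite /circle_coef /dft ReM_real Re_sum; congr (_ * _); apply: eq_bigr => j _.
by rewrite muln0 expr0 mulr1 mul1r.
Qed.

Section Discrepancy.
Variables (R : realType) (n N M G : nat) (A r L w l : R) (Q : {poly int}) (a : R[i])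
  (z : 'I_N -> R[i]).
Let om : R[i] := expi (2 * pi / G%:R).
(** The 8 balances two losses: the diagonal energy grows like ln(8 n), while the smoothing error at
    z_k is about A |z_k| sqrt(2 (1 - rho)) = A |z_k| / (2 sqrt(n)). *)
Let rho : R := 1 - (8 * n%:R)^-1.
Hypotheses (n_ge55 : (55 <= n)%N) (N_gt0 : (0 < N)%N) (Nn : (N <= n)%N)
  (A_gt0 : 0 < A) (r_gt0 : 0 < r)
  (w_ge0 : 0 <= w) (l_ge0 : 0 <= l) (wE : w ^+ 2 = n%:R) (lE : l ^+ 2 = L).
Hypotheses (a_neq0 : a != 0) (z_inj : injective z) (z_neq0 : forall k, z k != 0)
  (QE : map_poly intr Q = a *: \prod_(k < N) ('X - (z k)%:P)).
Hypotheses (ln_n : ln n%:R <= L) (ln_mahler : ln (cmod a * \prod_k Num.max 1 (cmod (z k))) <= L).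
Hypotheses (M_gt0 : (0 < M)%N) (M_large : rho ^+ M / (1 - rho) <= (1000 * n%:R)^-1)
  (MG : (M.*2 < G)%N) (G_large : M%:R * cmod (om - 1) <= 1000^-1).

Let n_ge : 55 <= n%:R :> R. Proof. by rewrite ler_nat. Qed.
Let n_gt0 : 0 < n%:R :> R. Proof. by apply: lt_le_trans n_ge. Qed.
Let L_ge : 7 / 2 <= L. Proof. exact: le_trans (ln_natr_ge _ n_ge55) ln_n. Qed.

Let inv_rho : 1 - rho = (8 * n%:R)^-1. Proof. by rewrite /rho subKr. Qed.

Let n_inv : 0 < n%:R^-1 :> R. Proof. by rewrite invr_gt0. Qed.
Let n_inv_le : n%:R^-1 <= 55^-1 :> R. Proof. by rewrite lef_pV2 ?posrE. Qed.

Let rhoE : rho = 1 - 8^-1 * n%:R^-1. Proof. by rewrite /rho invfM. Qed.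

Let rho_gt0 : 0 < rho. Proof. rewrite rhoE; move: n_inv n_inv_le; lra. Qed.
Let rho_lt1 : rho < 1. Proof. rewrite rhoE; move: n_inv n_inv_le; lra. Qed.

Let q_le : rho ^+ 2 <= rho.
Proof. by rewrite expr2 ler_piMr ?(ltW rho_gt0) ?(ltW rho_lt1). Qed.

Let tau_le : (rho ^+ 2) ^+ M / (1 - rho ^+ 2) <= (1000 * n%:R)^-1.
Proof.
apply: le_trans M_large; have r1 := rho_lt1; have q1 := q_le; have r0 := rho_gt0.
apply: ler_pM.
- by rewrite exprn_ge0 // sqr_ge0.
- by rewrite invr_ge0; lra.
- by rewrite lerXn2r ?nnegrE ?sqr_ge0 ?(ltW r0).
- by rewrite lef_pV2 ?posrE; lra.
Qed.

Let ln_rho : - ln rho <= (7 * n%:R)^-1.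
Proof.
have r0 := rho_gt0; rewrite -lnV ?posrE //.
have -> : rho^-1 = 1 + (rho^-1 - 1) by ring.
have rV : 1 <= rho^-1 by rewrite invf_ge1 // ltW.
apply: le_trans (le_ln1Dx _) _; first lra.
have -> : rho^-1 - 1 = (1 - rho) / rho by field; rewrite lt0r_neq0.
rewrite ler_pdivrMr // rhoE !invfM; move: n_inv n_inv_le; set m := n%:R^-1 => m0 m1; nra.
Qed.

Let ln_1q : - ln (1 - rho ^+ 2) <= 43 / 20 + L.
Proof.
have h : (8 * n%:R)^-1 <= 1 - rho ^+ 2 by rewrite -inv_rho lerD2l lerN2.
have h0 : 0 < (8 * n%:R)^-1 :> R by rewrite invr_gt0 mulr_gt0.
apply: (@le_trans _ _ (ln (8 * n%:R))).
  by rewrite lerNl -lnV ?posrE ?mulr_gt0 // ler_ln ?posrE // (lt_le_trans h0).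
rewrite lnM ?posrE //; apply: lerD => //; exact: ln8_le.
Qed.

(* [3 L + 43/20 + 1/7 + 1/1000 <= 183/50 L] because [L >= ln 55 >= 7/2]. *)
Let energy : 2 * N%:R * \sum_k ln (Num.max 1 (cmod (z k)))
    + \sum_k \sum_l smoothed_kernel (rho ^+ 2) M (z k) (z l) <= 183 / 50 * (w * l) ^+ 2.
Proof.
apply: le_trans (energy_le M N_gt0 a_neq0 z_inj z_neq0 QE rho_gt0 rho_lt1) _.
rewrite [(w * l) ^+ 2]exprMn wE lE.
have NR : N%:R <= n%:R :> R by rewrite ler_nat.
have N0 : 0 <= N%:R :> R by rewrite ler0n.
have L0 := L_ge.
have h1 : 2 * N%:R * ln (cmod a * \prod_k Num.max 1 (cmod (z k))) <= 2 * n%:R * L.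
  apply: (@le_trans _ _ (2 * N%:R * L)); first by rewrite ler_wpM2l // mulr_ge0.
  by rewrite ler_wpM2r ?ler_wpM2l //; lra.
have h2 : N%:R * - ln (1 - rho ^+ 2) <= n%:R * (43 / 20 + L).
  apply: (@le_trans _ _ (N%:R * (43 / 20 + L))); first by rewrite ler_wpM2l.
  by rewrite ler_wpM2r //; lra.
have h3 : N%:R ^+ 2 * (- ln rho + (rho ^+ 2) ^+ M / (1 - rho ^+ 2)) <=
    n%:R ^+ 2 * ((7 * n%:R)^-1 + (1000 * n%:R)^-1).
  apply: (@le_trans _ _ (N%:R ^+ 2 * ((7 * n%:R)^-1 + (1000 * n%:R)^-1))).
    by rewrite ler_wpM2l ?sqr_ge0 // lerD.
  apply: ler_wpM2r; first by rewrite !invfM; move: n_inv; lra.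
  by apply: lerXn2r; rewrite ?nnegrE ?(ltW n_gt0).
have h4 : n%:R ^+ 2 * ((7 * n%:R)^-1 + (1000 * n%:R)^-1) = (7^-1 + 1000^-1) * n%:R :> R.
  by rewrite !invfM; move: n_gt0 => n0; field; rewrite lt0r_neq0.
have h5 : n%:R * (7 / 2) <= n%:R * L by rewrite ler_wpM2l // ltW.
rewrite h4 in h3; move: h1 h2 h3 h5; lra.
Qed.

Let w_ge : 741 / 100 <= w.
Proof.
apply: le_of_sqr => //; rewrite wE; apply: le_trans n_ge; lra.
Qed.

Let l_ge : 187 / 100 <= l.
Proof.
apply: le_of_sqr => //; rewrite lE; apply: le_trans L_ge; lra.
Qed.

(** Each of these zeros adds at least 1 to ln M, as ln 3 >= 1 and |a| >= 1. Their number is thus at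
    most L and at most n, hence at most the geometric mean of the two. *)
Let count_le : \sum_(k < N) (if 3 <= cmod (z k) then 1 else 0) <= w * l.
Proof.
set c := \sum_(k < N) _.
have c0 : 0 <= c by apply: sumr_ge0 => k _; case: ifP.
have c1 : c <= n%:R.
  apply: (@le_trans _ _ (\sum_(k < N) 1)); first by apply: ler_sum => k _; case: ifP.
  by rewrite sumr_const card_ord ler_nat.
have c2 : c <= L.
  apply: le_trans ln_mahler.
  have mx0 k : 0 < Num.max 1 (cmod (z k)) by rewrite lt_max ltr01.
  have [p0 pE] := @prod_ln R _ (index_enum 'I_N) xpredT (fun k => Num.max 1 (cmod (z k)))
    (fun k _ => mx0 k).
  rewrite lnM ?posrE ?cmod_gt0 // pE.
  have a1 : 0 <= ln (cmod a) by rewrite ln_ge0 // (cmod_lead_ge1 a_neq0 QE).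
  rewrite -[c]add0r; apply: lerD => //; apply: ler_sum => k _.
  case: ifP => [h|_]; last by rewrite ln_ge0 // le_max lexx.
  by rewrite ln_ge1 // le_max h orbT.
rewrite -(@ler_pXn2r _ 2) ?nnegrE ?mulr_ge0 // exprMn wE lE expr2.
exact: ler_pM.
Qed.

Section OneFunction.
Variable phi : R[i] -> R.
Hypothesis phi_lip : forall z t : R[i], `|phi z - phi t| <= A * cmod (z - t).
Hypothesis phi_supp : forall z : R[i], r <= cmod z -> phi z = 0.

Let w_gt0 : 0 < w. Proof. by apply: lt_le_trans w_ge; lra. Qed.

(* Far zeros contribute little: those with [|z_k| >= 3] number at most
   [min n L <= sqrt (n L)]. *)
Let smoothing_error_le k :
  phi (z k) - smoothing G phi M rho (cmod (z k)) (z k / (cmod (z k))%:C%C) <=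
  A * (51 / 100 / w) * (3 + r * (if 3 <= cmod (z k) then 1 else 0)).
Proof.
have G0 : (0 < G)%N by exact: leq_ltn_trans MG.
have c0 : 0 <= A * (51 / 100 / w) by rewrite mulr_ge0 ?divr_ge0 ?(ltW A_gt0) //; lra.
have b0 : 0 <= 3 + r * (if 3 <= cmod (z k) then 1 else 0).
  by rewrite addr_ge0 // mulr_ge0 ?(ltW r_gt0) //; case: ifP.
have [rz|zr] := leP r (cmod (z k)).
  rewrite phi_supp // /smoothing (circle_coef_supp G phi_supp 0 rz) big1 => [|j _]; last first.
    by rewrite (circle_coef_supp G phi_supp j.+1 rz) mul0r mulr0.
  by rewrite mulr0 addr0 subrr mulr_ge0.
have cz : 0 < cmod (z k) by rewrite cmod_gt0.
have u1 : cmod (z k / (cmod (z k))%:C%C) = 1.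
  by rewrite cmodM cmodV cmod_real gtr0_norm // divff // lt0r_neq0.
(* The minimizer of lam / 2 + (1 - rho) / lam, with minimum 1 / (2 w). The truncation adds at most
   9/1000 / w, which 51/100 covers. *)
have lam0 : 0 < (2 * w)^-1 by rewrite invr_gt0 mulr_gt0.
have MG' : (M.+1 < G)%N by apply: leq_ltn_trans MG; rewrite -addnn -addn1 leq_add2l.
have := smoothing_error G0 (ltW A_gt0) phi_lip M_gt0 MG' rho_gt0 rho_lt1 (ltW cz) u1 lam0.
have -> : (cmod (z k))%:C%C * (z k / (cmod (z k))%:C%C) = z k.
  by rewrite mulrC divfK // fmorph_eq0 lt0r_neq0.
move=> /(le_trans (ler_norm _)) H; apply: le_trans H _.
set eta := rho ^+ M / (1 - rho).
have eta0 : 0 <= eta.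
  by apply: divr_ge0; [exact/exprn_ge0/ltW/rho_gt0 | rewrite subr_ge0; exact/ltW/rho_lt1].
have etaE : eta <= 1000^-1 * n%:R^-1 by rewrite -invfM.
have wV : w ^+ 2 * n%:R^-1 = 1 by rewrite wE divff // lt0r_neq0.
have ww : w * w^-1 = 1 by rewrite divff // lt0r_neq0.
have wi0 : 0 < w^-1 by rewrite invr_gt0.
have nE : n%:R^-1 = w^-1 ^+ 2 :> R by rewrite -wE exprVn.
have wi1 : w^-1 <= 1 by rewrite invf_le1 //; have := w_ge; lra.
have e1 : (2 * w)^-1 / 2 + (1 - rho) / (2 * w)^-1 = 2^-1 * w^-1.
  by rewrite inv_rho -wE; field; rewrite lt0r_neq0.
have e2 : 2 * (2 * w)^-1 + 4 / (2 * w)^-1 = w^-1 + 8 * w by field; rewrite lt0r_neq0.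
have e3 : eta * (w^-1 + 8 * w) <= 1000^-1 * n%:R^-1 * (w^-1 + 8 * w).
  by rewrite ler_wpM2r // addr_ge0 ?mulr_ge0 ?(ltW w_gt0) ?(ltW wi0).
have e4 : 1000^-1 * n%:R^-1 * (w^-1 + 8 * w) <= 9 / 1000 * w^-1.
  have -> : 1000^-1 * n%:R^-1 * (w^-1 + 8 * w) = 1000^-1 * w^-1 * (w^-1 ^+ 2 + 8).
    by rewrite nE; field; rewrite lt0r_neq0.
  have : w^-1 * w^-1 ^+ 2 <= w^-1 * 1.
    by rewrite ler_wpM2l ?(ltW wi0) // exprn_ile1 // ltW.
  lra.
have eB : (2 * w)^-1 / 2 + (1 - rho) / (2 * w)^-1 + eta * (2 * (2 * w)^-1 + 4 / (2 * w)^-1)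
    <= 51 / 100 / w by rewrite e1 e2; lra.
apply: (@le_trans _ _ (A * cmod (z k) * (51 / 100 / w))).
  by rewrite ler_wpM2l // mulr_ge0 ?cmod_ge0 ?(ltW A_gt0).
rewrite mulrAC ler_wpM2l //.
case: ifP => h; last by rewrite mulr0 addr0; move/negbT: h; rewrite -ltNge => /ltW.
by rewrite mulr1; move: zr; lra.
Qed.

Lemma discrepancy_le :
  \sum_k phi (z k) - N%:R * complex.Re (circle_coef G phi 0 1) <=
  A * (248 / 125 * r * (w * l) + 153 / 100 * w).
Proof.
have s0 : 0 < w * l by rewrite mulr_gt0 //; have := l_ge; lra.
have k0 : 0 <= 1000^-1 :> R by lra.
have k1 : 1000^-1 < 1 :> R by lra.
pose A1 := A / (1 - 1000^-1).
have A10 : 0 < A1 by apply: divr_gt0; [exact: A_gt0 | lra].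
(* The weight of [amgm_scale] for c = 4783/2500, just above the square root of the energy constant
   183/50. *)
pose lam := A1 * r / (4783 / 2500 * (w * l)).
have lam0 : 0 < lam.
  by apply: divr_gt0; [exact: mulr_gt0 | apply: mulr_gt0; [lra | exact: s0]].
have := smoothed_discrepancy_le rho (ltW A_gt0) r_gt0 M_gt0 MG k0 k1 G_large z_neq0
  phi_lip phi_supp lam0.
rewrite -[A / _]/A1 -exprMn.
set S := \sum_k smoothing _ _ _ _ _ _; set F0 := complex.Re _ => core.
have main : S - N%:R * F0 <= 4783 / 2500 * (A1 * r) * (w * l).
  have c0 : 0 < 4783 / 2500 :> R by lra.
  have ec : 183 / 50 <= (4783 / 2500) ^+ 2 :> R by lra.
  have := amgm_scale (mulr_gt0 A10 r_gt0) s0 c0 ec energy.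
  by move=> /(le_trans core); rewrite ler_pM2l.
have err : \sum_k phi (z k) - S <= A * (153 / 100 * w + 51 / 100 * r * l).
  rewrite -sumrB.
  apply: (@le_trans _ _ (\sum_k A * (51 / 100 / w) * (3 + r * (if 3 <= cmod (z k) then 1 else 0)))).
    by apply: ler_sum => k _; exact: smoothing_error_le.
  rewrite -mulr_sumr big_split /= -mulr_sumr sumr_const card_ord.
  have -> : A * (153 / 100 * w + 51 / 100 * r * l) = A * (51 / 100 / w) * (3 * w ^+ 2 + r * (w * l)).
    by field; rewrite lt0r_neq0.
  have c0 : 0 <= A * (51 / 100 / w).
    by apply: mulr_ge0; [exact: ltW | apply: divr_ge0; [lra | exact: ltW]].
  apply: ler_wpM2l => //; apply: lerD; last by rewrite ler_wpM2l ?(ltW r_gt0) // count_le.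
  by rewrite wE -[3 *+ N]mulr_natr ler_wpM2l // ler_nat.
(* The far zeros join the main term through l <= w l / 7.41, and 1000/999 * 4783/2500 + 0.51/7.41 <
   248/125. *)
have lw : 741 / 100 * (A * r * l) <= w * (A * r * l).
  by rewrite ler_wpM2r ?w_ge // !mulr_ge0 ?(ltW A_gt0) ?(ltW r_gt0).
have A1E : A1 = 1000 / 999 * A by rewrite /A1; field.
rewrite A1E in main.
have p0 := mulr_gt0 (mulr_gt0 A_gt0 r_gt0) s0.
move: main err lw p0; lra.
Qed.

End OneFunction.

Lemma discrepancy_abs_le (phi : R[i] -> R) :
  (forall z t : R[i], `|phi z - phi t| <= A * cmod (z - t)) ->
  (forall z : R[i], r <= cmod z -> phi z = 0) ->
  `|\sum_k phi (z k) - N%:R * complex.Re (circle_coef G phi 0 1)| <=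
  A * (248 / 125 * r * (w * l) + 153 / 100 * w).
Proof.
move=> lip supp; rewrite ler_norml; apply/andP; split; last exact: discrepancy_le.
have lipN u t : `|- phi u - - phi t| <= A * cmod (u - t) by rewrite -opprD normrN.
have suppN u : r <= cmod u -> - phi u = 0 by move=> /supp ->; rewrite oppr0.
have := discrepancy_le lipN suppN.
by rewrite !Re_circle_coef0 !sumrN !mulrN -opprD lerNl.
Qed.

End Discrepancy.

(** The support condition settles only the points outside the closed disc. A point with |z| = r is
    pushed outwards by a factor 1 + s, which changes phi by an arbitrarily small amount. *)
Lemma lipschitz_supp_eq0 (R : realType) (A r : R) (phi : R[i] -> R) : 0 < A -> 0 < r ->
  (forall z t : R[i], `|phi z - phi t| <= A * cmod (z - t)) ->
  fun_supp phi `<=` [set z | cmod z <= r] ->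
  forall z : R[i], r <= cmod z -> phi z = 0.
Proof.
move=> A0 r0 lip supp.
have out z : r < cmod z -> phi z = 0.
  move=> rz; apply/eqP/negP => /negP pz.
  have : fun_supp phi z by apply: subset_closure.
  by move/supp => /=; rewrite leNgt rz.
move=> z rz; apply/eqP; rewrite -normr_le0; apply/ler_addgt0Pr => e e0; rewrite add0r.
have cz : 0 < cmod z by exact: lt_le_trans rz.
pose s := e / (A * cmod z).
have s0 : 0 < s by rewrite divr_gt0 // mulr_gt0.
have zz : r < cmod ((1 + s)%:C%C * z).
  rewrite cmodM cmod_real gtr0_norm ?addr_gt0 //; apply: le_lt_trans rz _.
  by rewrite ltr_pMl // ltrDl.
have := lip z ((1 + s)%:C%C * z); rewrite (out _ zz) subr0.
have -> : z - (1 + s)%:C%C * z = - (s%:C%C * z) by rewrite rmorphD rmorph1; ring.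
rewrite cmodN cmodM cmod_real (gtr0_norm s0).
suff -> : A * (s * cmod z) = e by [].
by rewrite /s; move: (cmod z) cz => c c0; field; rewrite !lt0r_neq0.
Qed.

(** The root 0 is an integer, so X can be split off over the integers and the quotient keeps integer
    coefficients. *)
Lemma remove_zero_root (R : realType) (n : nat) (P : {poly int}) (a : R[i])
    (alpha : 'I_n -> R[i]) (k0 : 'I_n) : alpha k0 = 0 ->
  map_poly intr P = a *: \prod_(k < n) ('X - (alpha k)%:P) ->
  exists Q : {poly int},
    map_poly intr Q = a *: \prod_(k < n.-1) ('X - (alpha (lift k0 k))%:P).
Proof.
move=> k00; rewrite (bigD1_ord k0) //= k00 polyC0 subr0 => PE.
have /factor_theorem[Q QE] : root P 0.
  apply/rootP; have := congr1 (fun p : {poly R[i]} => p.[0]) PE.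
  rewrite hornerZ hornerM hornerX mul0r mulr0.
  have -> : (0 : R[i]) = 0%:~R by [].
  rewrite horner_map => /eqP; rewrite intr_eq0 => /eqP //.
exists Q; apply: (@mulIf _ 'X); first by rewrite polyX_eq0.
move: PE; rewrite QE polyC0 subr0 rmorphM /= map_polyX => ->.
by rewrite mulrC scalerAl mulrC.
Qed.

(** At most one zero is 0. Dividing it out changes neither the leading coefficient nor the Mahler
    measure, and its own share |phi(0) - mean| is at most A, since 0 has distance 1 from the unit
    circle; this is the summand 1. *)
Lemma discrepancy_simple_zeros (R : realType) (n M G : nat) (A r L w l : R) (P : {poly int})
    (a : R[i]) (alpha : 'I_n -> R[i]) (phi : R[i] -> R)
    (rho : R := 1 - (8 * n%:R)^-1) (om := expi (2 * pi / G%:R) : R[i]) :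
  (55 <= n)%N -> 0 < A -> 0 < r -> 0 <= w -> 0 <= l -> w ^+ 2 = n%:R -> l ^+ 2 = L ->
  a != 0 -> injective alpha -> map_poly intr P = a *: \prod_(k < n) ('X - (alpha k)%:P) ->
  ln n%:R <= L -> ln (cmod a * \prod_k Num.max 1 (cmod (alpha k))) <= L ->
  (0 < M)%N -> rho ^+ M / (1 - rho) <= (1000 * n%:R)^-1 ->
  (M.*2 < G)%N -> M%:R * cmod (om - 1) <= 1000^-1 ->
  (forall z t : R[i], `|phi z - phi t| <= A * cmod (z - t)) ->
  (forall z : R[i], r <= cmod z -> phi z = 0) ->
  `|\sum_k phi (alpha k) - n%:R * complex.Re (circle_coef G phi 0 1)| <=
  A * (248 / 125 * r * (w * l) + 153 / 100 * w + 1).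
Proof.
move=> n55 A0 r0 w0 l0 wE lE a0 inj PE lnn lnm M0 Mb MG Gb lip supp.
have A1 : A * (248 / 125 * r * (w * l) + 153 / 100 * w) <=
    A * (248 / 125 * r * (w * l) + 153 / 100 * w + 1).
  by rewrite ler_wpM2l ?(ltW A0) // lerDl.
have [/forallP nz|] := boolP [forall k, alpha k != 0].
  apply: le_trans A1.
  by apply: (discrepancy_abs_le n55 _ (leqnn n) A0 r0 w0 l0 wE lE a0 inj nz PE lnn lnm
    M0 Mb MG Gb lip supp); exact: leq_trans n55.
rewrite negb_forall => /existsP[k0]; rewrite negbK => /eqP k00.
have [Q QE] := remove_zero_root k00 PE.
have n1 : (0 < n.-1)%N by rewrite -ltnS prednK; apply: leq_trans n55.
have injl : injective (fun k => alpha (lift k0 k)) by move=> i j /inj /lift_inj.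
have nz k : alpha (lift k0 k) != 0.
  rewrite -k00; apply/eqP => /inj /eqP; rewrite eq_sym; apply/negP; exact: neq_lift.
have lnm' : ln (cmod a * \prod_k Num.max 1 (cmod (alpha (lift k0 k)))) <= L.
  apply: le_trans lnm; rewrite (bigD1_ord k0) //= k00 cmod0 max_l ?ler01 // mul1r.
  exact: lexx.
have H := discrepancy_abs_le n55 n1 (leq_pred n) A0 r0 w0 l0 wE lE a0 injl nz QE lnn lnm'
  M0 Mb MG Gb lip supp.
rewrite (bigD1_ord k0) //= k00.
set F0 := complex.Re _ in H *.
have G0 : (0 < G)%N by exact: leq_ltn_trans MG.
have F0d : `|phi 0 - F0| <= A.
  rewrite /F0 Re_circle_coef0.
  have GR : (0 : R) < G%:R by rewrite ltr0n.
  have -> : phi 0 = G%:R^-1 * \sum_(j < G) phi 0.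
    by rewrite sumr_const card_ord -[phi 0 *+ G]mulr_natl mulKf // lt0r_neq0.
  rewrite -mulrBr -sumrB normrM gtr0_norm ?invr_gt0 // mulrC ler_pdivrMr //.
  apply: le_trans (ler_norm_sum _ _ _) _.
  apply: (@le_trans _ _ (\sum_(j < G) A)); last by rewrite sumr_const card_ord mulr_natr.
  apply: ler_sum => j _; apply: le_trans (lip _ _) _.
  by rewrite sub0r cmodN cmodX cmod_expi expr1n mulr1.
have nE : n%:R = 1 + (n.-1)%:R :> R by rewrite addrC natr1 prednK //; apply: leq_trans n55.
have -> : phi 0 + \sum_(i < n.-1) phi (alpha (lift k0 i)) - n%:R * F0 =
  (phi 0 - F0) + (\sum_(i < n.-1) phi (alpha (lift k0 i)) - (n.-1)%:R * F0).
  by rewrite nE; ring.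
apply: le_trans (ler_normD _ _) _; apply: le_trans (lerD F0d H) _.
rewrite le_eqVlt; apply/orP; left; apply/eqP; ring.
Qed.

Theorem theorem3p1 (R : realType) (A r : R) (phi : R[i] -> R)
    (n : nat) (P : {poly int}) (a : R[i]) (alpha : 'I_n -> R[i]) :
  0 < A -> 0 < r ->
  (forall z t : R[i], `|phi z - phi t| <= A * cmod (z - t)) ->
  fun_supp phi `<=` [set z | cmod z <= r] ->
  (55 <= n)%N ->
  a != 0 ->
  map_poly intr P = a *: \prod_(k < n) ('X - (alpha k)%:P) ->
  injective alpha ->
  `| n%:R^-1 * (\sum_(k < n) phi (alpha k)) - circle_integral phi |
    <= A * (2 * r + 1) *
       Num.sqrt (ln (Num.max n%:R (mahler_measure (map_poly intr P))) / n%:R).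
Proof.
move=> A0 r0 lip supp n55 a0 PE inj.
have supp0 := lipschitz_supp_eq0 A0 r0 lip supp.
have n55R : (55 : R) <= n%:R by rewrite ler_nat.
have n0 : (0 : R) < n%:R by apply: lt_le_trans n55R.
have mE : mahler_measure (map_poly intr P) = cmod a * \prod_k Num.max 1 (cmod (alpha k)).
  by rewrite PE mahler_measureE.
set mx := Num.max _ _; set L := ln mx.
have mahler0 : 0 < cmod a * \prod_k Num.max 1 (cmod (alpha k)).
  rewrite mulr_gt0 ?cmod_gt0 //.
  by apply: (big_ind (fun x : R => 0 < x)) => // [x y|k _]; [exact: mulr_gt0 | rewrite lt_max ltr01].
have lnn : ln n%:R <= L.
  by rewrite /L ler_ln ?posrE ?lt_max ?n0 // le_max lexx.
have lnm : ln (cmod a * \prod_k Num.max 1 (cmod (alpha k))) <= L.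
  by rewrite /L ler_ln ?posrE ?lt_max ?n0 // /mx mE le_max lexx orbT.
have L1 : 7 / 2 <= L by exact: le_trans (ln_natr_ge _ n55) lnn.
(* With [l] written as [y * w], n y becomes w l without any computation with square roots; [l] is
   the square root of L. *)
set y := Num.sqrt _; pose w : R := Num.sqrt n%:R; pose l := y * w.
have y0 : 0 <= y by exact: sqrtr_ge0.
have w0 : 0 <= w by exact: sqrtr_ge0.
have l0 : 0 <= l by exact: mulr_ge0.
have wE : w ^+ 2 = n%:R by rewrite sqr_sqrtr // ltW.
have Ln0 : 0 <= L / n%:R by apply: divr_ge0; [lra | exact: ltW].
have lE : l ^+ 2 = L by rewrite exprMn wE sqr_sqrtr // divfK // lt0r_neq0.
pose rho : R := 1 - (8 * n%:R)^-1.
have ni0 : (0 : R) < n%:R^-1 by rewrite invr_gt0.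
have ni1 : n%:R^-1 <= 55^-1 :> R by rewrite lef_pV2 ?posrE.
have rho0 : 0 < rho by rewrite /rho invfM; lra.
have rho1 : rho < 1 by rewrite /rho invfM; lra.
have e0 : 0 < (1000 * n%:R)^-1 :> R by rewrite invfM; lra.
have [M M0 Mb] := exists_geometric_le rho0 rho1 e0.
have MR : (0 : R) < M%:R^-1 by rewrite invr_gt0 ltr0n.
have MR1 : M%:R^-1 <= (1 : R) by rewrite invf_le1 ?ler1n // ltr0n.
(* The truncation order M is fixed before the grid. This tolerance serves twice: times M it keeps
   the angular loss below 1/1000, and by itself it keeps the error of the circle mean below A /
   (1000 n). *)
have d0 : 0 < (1000 * n%:R)^-1 * M%:R^-1 :> R by exact: mulr_gt0.
have [G MG Gd] := exists_fine_grid M d0.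
set d := cmod _ in Gd.
have Gn : d <= 1000^-1 * n%:R^-1.
  by apply: le_trans Gd _; rewrite invfM; apply: ler_piMr; [lra | exact: MR1].
have Mn0 : M%:R != 0 :> R by rewrite pnatr_eq0 -lt0n.
have Gb : M%:R * d <= 1000^-1.
  have := ler_wpM2l (ler0n R M) Gd; rewrite mulrCA (mulfV Mn0) mulr1 invfM; lra.
have main := discrepancy_simple_zeros n55 A0 r0 w0 l0 wE lE a0 inj PE lnn lnm M0 Mb MG Gb
  lip supp0.
have G1 : (1 < G)%N by apply: leq_ltn_trans MG; rewrite -addnn -(addn1 0); exact: leq_add.
have circ := circle_integral_mean (ltW A0) lip G1.
rewrite -Re_circle_coef0 -/d in circ; set F0 := complex.Re _ in main circ.
have -> : n%:R^-1 * \sum_(k < n) phi (alpha k) - circle_integral phi =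
  n%:R^-1 * (\sum_(k < n) phi (alpha k) - n%:R * F0) - (circle_integral phi - F0).
  by rewrite mulrBr mulKf ?lt0r_neq0 //; ring.
apply: le_trans (ler_normB _ _) _; rewrite normrM gtr0_norm //.
have h1 := ler_wpM2l (ltW ni0) main.
have h2 := le_trans circ (ler_wpM2l (ltW A0) Gn).
apply: le_trans (lerD h1 h2) _.
have w1 : 741 / 100 <= w.
  apply: le_of_sqr => //; rewrite wE; apply: le_trans n55R; lra.
have l1 : 187 / 100 <= l.
  apply: le_of_sqr => //; rewrite lE; apply: le_trans L1; lra.
have wp : 0 < w by apply: lt_le_trans w1; lra.
have -> : n%:R^-1 * (A * (248 / 125 * r * (w * l) + 153 / 100 * w + 1)) + A * (1000^-1 * n%:R^-1)
  = A * (n%:R^-1 * (248 / 125 * r * (w * l) + 153 / 100 * w + 1001 / 1000)).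
  by field; rewrite lt0r_neq0.
rewrite -[leRHS]mulrA; apply: ler_wpM2l; first exact: ltW.
rewrite ler_pdivrMl //.
have -> : n%:R * ((2 * r + 1) * y) = 2 * (r * (w * l)) + w * l by rewrite -wE /l; ring.
(* The summand 1 of 2 r + 1 provides w l >= 1.87 w, and 0.34 w >= 2.5 exceeds the constant 1001/1000
   left by the zero at the origin and the circle mean. *)
have q1 : 187 / 100 * w <= w * l by rewrite mulrC ler_wpM2l.
have q2 : 0 <= r * (w * l) by rewrite !mulr_ge0 // ltW.
lra.
Qed.
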